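(* Let $F$ be a free group and let $R\subseteq S$ be normal subgroups of $F$. Then $$D(F,\mathbf{r}\mathbf{s}\mathbf{f}\mathbf{r})=D(F,\mathbf{r}\mathbf{f}\mathbf{s}\mathbf{r})=[R\cap S',\,R\cap S',\,R]\,\gamma_4(R).$$
   Context: For a normal subgroup $R$ of the free group $F$, $\mathbf{r}=\Delta(R)\mathbb{Z}[F]=(R-1)\mathbb{Z}[F]$ is the two-sided ideal of the integral group ring $\mathbb{Z}[F]$ generated by the augmentation ideal $\Delta(R)$ of $\mathbb{Z}[R]$; similarly $\mathbf{s}$ for $S$, and $\mathbf{f}=\Delta(F)$ is the augmentation ideal of $\mathbb{Z}[F]$. Juxtaposition denotes products of ideals. For a two-sided ideal $\mathfrak{a}$ of $\mathbb{Z}[F]$, $D(F,\mathfrak{a})=F\cap(1+\mathfrak{a})=\{g\in F: g-1\in\mathfrak{a}\}$. $S'=[S,S]$ is the derived subgroup, $[A,B]$ is the subgroup generated by the commutators of elements of $A$ with elements of $B$, $[A,B,C]=[[A,B],C]$ is the left-normed commutator subgroup, and $\{\gamma_i(R)\}_{i\ge1}$ is the lower central series of $R$ ($\gamma_1(R)=R$). *)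

(* Defs.v *)
From HB Require Import structures.
From mathcomp Require Import all_boot all_algebra finmap.
From mathcomp Require Import classical_sets monalg.

Set Implicit Arguments.
Unset Strict Implicit.
Unset Printing Implicit Defensive.

Import GRing.Theory.

Local Open Scope classical_set_scope.
Local Open Scope ring_scope.

Definition free_on (F : groupType) (X : Type) (i : X -> F) : Prop :=
  forall (G : groupType) (f : X -> G),
    exists phi : {multiplicative F -> G},
      (forall x, phi (i x) = f x) /\
      (forall psi : {multiplicative F -> G},
         (forall x, psi (i x) = f x) -> psi =1 phi).

Definition free_group (F : groupType) : Prop :=
  exists (X : Type) (i : X -> F), free_on i.

Section Subgroups.
Variable F : groupType.
Implicit Types A B H R : set F.

Definition subgroup H : Prop :=
  H 1%g /\ (forall x y, H x -> H y -> H (x / y)%g).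

Definition normal_subgroup H : Prop :=
  subgroup H /\ (forall x g, H x -> H (x ^ g)%g).

Definition commutator_subgroup A B : set F :=
  smallest subgroup [set [~ a, b]%g | a in A & b in B].

(* Indexed from 1, with gamma_1(R) = R; the value at 0 is junk. *)
Definition lower_central R (n : nat) : set F :=
  iter n.-1 (fun H => commutator_subgroup H R) R.

Definition subset_mul A B : set F := [set (a * b)%g | a in A & b in B].

End Subgroups.

(* The convolution ring structure that monalg puts on {malg R[K]} requires
   x * y = 1 -> x = 1 /\ y = 1 in K, which fails in groups; hence the alias
   and the ring instance below. *)
Definition group_ring (F : groupType) := {malg int[F]}.

HB.instance Definition _ (F : groupType) :=
  GRing.Zmodule.on (group_ring F).

Section GroupRing.
Variable F : groupType.
Implicit Types u v w : group_ring F.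

Definition gr_of (x : F) : group_ring F := << 1 *g x >>.

Definition gr_mul u v : group_ring F :=
  \sum_(x <- msupp u) \sum_(y <- msupp v) << u@_x * v@_y *g (x * y)%g >>.

Local Open Scope fset_scope.

Lemma gr_mulEw (d1 d2 : {fset F}) u v :
  msupp u `<=` d1 -> msupp v `<=` d2 ->
  gr_mul u v =
  \sum_(x <- d1) \sum_(y <- d2) << u@_x * v@_y *g (x * y)%g >>.
Proof.
move=> le1 le2; rewrite /gr_mul (big_fset_incl _ le1) /=.
  apply/eq_bigr=> x _; apply/big_fset_incl => // y _ /mcoeff_outdom ->.
  by rewrite mulr0 monalgU0.
move=> x _ /mcoeff_outdom ux.
by rewrite big1 => // y _; rewrite ux mul0r monalgU0.
Qed.

Lemma gr_mul0l : left_zero 0 gr_mul.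
Proof. by move=> u; rewrite /gr_mul msupp0 big_seq_fset0. Qed.

Lemma gr_mul0r : right_zero 0 gr_mul.
Proof.
by move=> u; rewrite /gr_mul msupp0 big1 // => x _; rewrite big_seq_fset0.
Qed.

Lemma gr_mulUU (c d : int) (x y : F) :
  gr_mul << c *g x >> << d *g y >> = << c * d *g (x * y)%g >>.
Proof. by rewrite (gr_mulEw msuppU_le msuppU_le) !big_seq_fset1 !mcoeffUU. Qed.

Lemma gr_mulDl : left_distributive gr_mul +%R.
Proof.
move=> u v w.
rewrite (gr_mulEw (msuppD_le u v) (fsubset_refl (msupp w))).
rewrite (gr_mulEw (fsubsetUl (msupp u) (msupp v)) (fsubset_refl (msupp w))).
rewrite (gr_mulEw (fsubsetUr (msupp u) (msupp v)) (fsubset_refl (msupp w))).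
rewrite -big_split /=; apply/eq_bigr => x _.
rewrite -big_split /=; apply/eq_bigr => y _.
by rewrite mcoeffD mulrDl monalgUD.
Qed.

Lemma gr_mulDr : right_distributive gr_mul +%R.
Proof.
move=> u v w.
rewrite (gr_mulEw (fsubset_refl (msupp u)) (msuppD_le v w)).
rewrite (gr_mulEw (fsubset_refl (msupp u)) (fsubsetUl (msupp v) (msupp w))).
rewrite (gr_mulEw (fsubset_refl (msupp u)) (fsubsetUr (msupp v) (msupp w))).
rewrite -big_split /=; apply/eq_bigr => x _.
rewrite -big_split /=; apply/eq_bigr => y _.
by rewrite mcoeffD mulrDr monalgUD.
Qed.

Lemma gr_ext (f g : group_ring F -> group_ring F) :
    {morph f : u v / (u + v)%R} -> {morph g : u v / (u + v)%R} ->
    f 0 = 0 -> g 0 = 0 ->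
  (forall (c : int) (x : F), f << c *g x >> = g << c *g x >>) -> f =1 g.
Proof.
move=> fD gD f0 g0 fg u; rewrite [u]monalgE.
rewrite (big_morph f fD f0) (big_morph g gD g0).
by apply: eq_bigr => x _; exact: fg.
Qed.

Lemma gr_mulA : associative gr_mul.
Proof.
move=> u v w; move: u.
apply: (@gr_ext (fun u => gr_mul u (gr_mul v w))
                (fun u => gr_mul (gr_mul u v) w)) => [??|??|||c x].
- by rewrite gr_mulDl.
- by rewrite !gr_mulDl.
- by rewrite gr_mul0l.
- by rewrite !gr_mul0l.
move: v; apply: (@gr_ext (fun v => gr_mul << c *g x >> (gr_mul v w))
                (fun v => gr_mul (gr_mul << c *g x >> v) w)) => [??|??|||d y].
- by rewrite gr_mulDl gr_mulDr.
- by rewrite gr_mulDr gr_mulDl.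
- by rewrite gr_mul0l gr_mul0r.
- by rewrite gr_mul0r gr_mul0l.
move: w; apply: (@gr_ext (fun w => gr_mul << c *g x >> (gr_mul << d *g y >> w))
     (fun w => gr_mul (gr_mul << c *g x >> << d *g y >>) w)) => [??|??|||e z].
- by rewrite !gr_mulDr.
- by rewrite gr_mulDr.
- by rewrite !gr_mul0r.
- by rewrite gr_mul0r.
by rewrite !gr_mulUU mulrA mulgA.
Qed.

Lemma gr_mul1l : left_id (gr_of 1%g) gr_mul.
Proof.
apply: (@gr_ext (gr_mul (gr_of 1%g)) id) => // [u v||c x].
- by rewrite gr_mulDr.
- by rewrite gr_mul0r.
by rewrite gr_mulUU mul1r mul1g.
Qed.

Lemma gr_mul1r : right_id (gr_of 1%g) gr_mul.
Proof.
apply: (@gr_ext (gr_mul^~ (gr_of 1%g)) id) => // [u v||c x].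
- by rewrite gr_mulDl.
- by rewrite gr_mul0l.
by rewrite gr_mulUU mulr1 mulg1.
Qed.

Lemma gr_of1_neq0 : gr_of 1%g != 0.
Proof. by rewrite /gr_of monalgU_eq0 oner_eq0. Qed.

HB.instance Definition _ := GRing.Zmodule_isNzRing.Build (group_ring F)
  gr_mulA gr_mul1l gr_mul1r gr_mulDl gr_mulDr gr_of1_neq0.

Lemma gr_of1 : gr_of 1%g = 1.
Proof. by []. Qed.

Lemma gr_ofM (x y : F) : gr_of (x * y)%g = gr_of x * gr_of y.
Proof. by rewrite [RHS]gr_mulUU mulr1. Qed.

End GroupRing.

Section Ideals.
Variable F : groupType.
Implicit Types A B : set (group_ring F).

Definition augmentation (u : group_ring F) : int := \sum_(x <- msupp u) u@_x.

(* Delta(H), the augmentation ideal of Z[H], as a subset of Z[F]. *)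
Definition aug_ideal (H : set F) : set (group_ring F) :=
  [set u | (forall x : F, x \in msupp u -> H x) /\ augmentation u = 0].

Definition additive_subgroup A : Prop :=
  A 0 /\ (forall u v, A u -> A v -> A (u - v)).

(* The additive subgroup of finite sums of products a * b. *)
Definition ideal_mul A B : set (group_ring F) :=
  smallest additive_subgroup [set a * b | a in A & b in B].

Definition rel_ideal (H : set F) : set (group_ring F) :=
  ideal_mul (aug_ideal H) setT.

Definition dimension_subgroup A : set F := [set g | A (gr_of g - 1)].

End Ideals.

Notation "A ** B" := (ideal_mul A B) (at level 40, left associativity).

(* Main.v *)
(** Write Delta for the augmentation ideal of Z[R].  Both fs and sf meet Z[R] in
the same set as Delta(S)^2, and modulo Delta^4 only the degree 3 part of the Lie ring of R
matters.

Freeness of F is used through potentials: a function on F with prescribed increments along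
the edges of the Cayley graph exists and is unique up to a constant.  Potentials show that
N/[N,N] is torsion-free for every subgroup N, and they lift homomorphisms R -> Z to crossed
homomorphisms R -> Z[R], whence for f1, f3 : R -> Z and f2 : S -> Z a functional on Z[F] that
kills r(fs)r and maps (a - 1)(b - 1)(c - 1) to f1(a) f2(b) f3(c).

Now let g - 1 be in r(fs)r.  Functionals of this kind in lower degree put g in gamma_3(R).
Choose elements e_i of R, independent in R/R', such that g is a combination, modulo
gamma_4(R), of the [e_i, e_j, e_k] and such that the e_i outside S' are independent in S/S';
this is possible because S/S' is torsion-free.  By the functionals, the coefficient of
e_a e_b e_c in the expansion of g - 1 vanishes whenever e_b is outside S', and then the
Jacobi identity rewrites g as a combination of the [e_i, e_j, e_k] with e_i, e_j in S'. *)

From HB Require Import structures.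
Require Import Defs.
From mathcomp Require Import all_boot all_algebra finmap.
From mathcomp Require Import boolp classical_sets monalg ring zify.

Set Implicit Arguments.
Unset Strict Implicit.
Unset Printing Implicit Defensive.

Import GRing.Theory.

Local Open Scope classical_set_scope.
Local Open Scope ring_scope.

(** * Potentials on the Cayley graph of a free group *)

(* The semidirect product of the right F-module of functions F -> M by F. *)
Definition translation_ext (F : groupType) (M : zmodType) : Type :=
  ((F -> M) * F)%type.

Section TranslationExt.
Variables (F : groupType) (M : zmodType).
Local Notation W := (translation_ext F M).

HB.instance Definition _ := gen_eqMixin W.
HB.instance Definition _ := gen_choiceMixin W.

Definition tmul (u v : W) : W := (fun k => u.1 k + v.1 (k * u.2)%g, (u.2 * v.2)%g).
Definition tone : W := (fun=> 0, 1%g).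
Definition tinv (u : W) : W := (fun k => - u.1 (k / u.2)%g, (u.2^-1)%g).

Lemma tmulA : associative tmul.
Proof.
by move=> u v w; congr (_, _); rewrite ?mulgA //; apply/funext => k; rewrite addrA mulgA.
Qed.

Lemma tmul1 : left_id tone tmul.
Proof.
move=> [u g]; congr (_, _); last by rewrite mul1g.
by apply/funext => k; rewrite add0r mulg1.
Qed.

Lemma tmul1r : right_id tone tmul.
Proof.
move=> [u g]; congr (_, _); last by rewrite mulg1.
by apply/funext => k; rewrite addr0.
Qed.

Lemma tmulV : left_inverse tone tinv tmul.
Proof.
move=> [u g]; congr (_, _); last by rewrite /= mulVg.
by apply/funext => k; rewrite /= addNr.
Qed.

Lemma tmulrV : right_inverse tone tinv tmul.
Proof.
move=> [u g]; congr (_, _); last by rewrite /= mulgV.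
by apply/funext => k; rewrite /= mulgK subrr.
Qed.

HB.instance Definition _ := isGroup.Build W tmulA tmul1 tmul1r tmulV tmulrV.

End TranslationExt.

Section Potentials.
Variables (F : groupType) (X : Type) (i : X -> F).
Hypothesis freeF : free_on i.

Lemma free_on_uniq (G : groupType) (f g : F -> G) :
    {morph f : x y / (x * y)%g} -> {morph g : x y / (x * y)%g} ->
  (forall x, f (i x) = g (i x)) -> f =1 g.
Proof.
move=> fM gM fg x.
pose f' := HB.pack_for {multiplicative F -> G} f (monoid.isMultiplicative.Build _ _ f fM).
pose g' := HB.pack_for {multiplicative F -> G} g (monoid.isMultiplicative.Build _ _ g gM).
have [phi [_ uniq]] := freeF (fun x => f (i x)).
by rewrite -[f]/(f' : F -> G) (uniq f') // -[g]/(g' : F -> G) (uniq g') //= => y; rewrite fg.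
Qed.

(** The homomorphism [phi] extending i x |-> (m x, i x) to the semidirect product is the identity in
    the second component, and h k is the value at 1 of the function component of [phi k]. *)
Lemma potential (M : zmodType) (m : X -> F -> M) :
  exists2 h : F -> M, h 1%g = 0 & forall k x, h (k * i x)%g = h k + m x k.
Proof.
have [phi [phiX _]] := freeF (fun x => (m x, i x) : translation_ext F M).
have phi2 k : (phi k).2 = k.
  apply: (@free_on_uniq F (fun k => (phi k).2) id) => [x y|x y|x] //=.
    by rewrite gmulfM.
  by rewrite phiX.
exists (fun k => (phi k).1 1%g) => [|k x].
  have -> // : phi 1%g = 1%g.
  by apply: (mulgI (phi 1%g)); rewrite -gmulfM !mulg1.
rewrite gmulfM [LHS]/(_ + _) phiX /=; congr (_ + m x _).
by rewrite mul1g -[RHS]phi2.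
Qed.

(** The homomorphisms g |-> (0, g) and g |-> (z |-> h (z g) - h z, g) to the semidirect product
    agree on the generators, hence everywhere; evaluate at z = 1. *)
Lemma potential_uniq (M : zmodType) (h : F -> M) :
  (forall k x, h (k * i x)%g = h k) -> forall k, h k = h 1%g.
Proof.
move=> hX k.
have /(congr1 (fun u => u.1 1%g)) /= : (fun=> 0, k) = (fun z => h (z * k)%g - h z, k)
    :> translation_ext F M.
  apply: (@free_on_uniq (translation_ext F M) (fun g => (fun=> 0, g))
    (fun g => (fun z => h (z * g)%g - h z, g))) => [x y|x y|x].
  - by congr (_, _); apply/funext => z; rewrite /= addr0.
  - congr (_, _); apply/funext => z /=.
    by rewrite mulgA [RHS]addrC addrA subrK.
  - by congr (_, _); apply/funext => z; rewrite hX subrr.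
by rewrite mul1g => /esym/eqP; rewrite subr_eq0 => /eqP.
Qed.

(** The indicator function of P has increment 0 along every edge of the Cayley graph and is
    therefore constant. The equivalence in the step accounts for inverse generators. *)
Lemma free_ind (P : F -> Prop) :
  P 1%g -> (forall g x, P g <-> P (g * i x)%g) -> forall g, P g.
Proof.
move=> P1 PX g; apply/asboolP.
suff: (`[<P g>] : nat)%:Z = 1 by case: `[<P g>].
rewrite (@potential_uniq int (fun g => (`[<P g>] : nat)%:Z)) ?(asboolT P1) // => k x.
by rewrite -(asbool_equiv_eq (PX k x)).
Qed.

End Potentials.

(** A homomorphism from H is encoded as a function on all of F whose values off H are arbitrary. *)
Definition hom_on (F : groupType) (H : set F) (A : zmodType) (f : F -> A) : Prop :=
  forall x y, H x -> H y -> f (x * y)%g = f x + f y.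

(** * Subgroups, commutator subgroups, cosets and abelian quotients *)

Section SubgroupTheory.
Variable F : groupType.
Implicit Types (A B H K R : set F) (M : zmodType).

Lemma subgroupV H x : subgroup H -> H x -> H (x^-1)%g.
Proof. by case=> H1 HF Hx; rewrite -[_^-1%g]mul1g; apply: HF. Qed.

Lemma subgroupM H x y : subgroup H -> H x -> H y -> H (x * y)%g.
Proof. by move=> sH Hx Hy; rewrite -[y]invgK; apply: sH.2 => //; apply: subgroupV. Qed.

Lemma subgroupR H x y : subgroup H -> H x -> H y -> H [~ x, y]%g.
Proof.
by move=> sH Hx Hy; do ![apply: subgroupM => //]; apply: subgroupV.
Qed.

Lemma hom_on1 H M (f : F -> M) : subgroup H -> hom_on H f -> f 1%g = 0.
Proof.
move=> [H1 _] fM; apply: (@addrI _ (f 1%g)).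
by rewrite -fM // mulg1 addr0.
Qed.

Lemma hom_onV H M (f : F -> M) x :
  subgroup H -> hom_on H f -> H x -> f (x^-1)%g = - f x.
Proof.
move=> sH fM Hx; apply: (@addrI _ (f x)).
by rewrite -fM ?mulgV ?(hom_on1 sH fM) ?subrr //; apply: subgroupV.
Qed.

Lemma commutator_is_subgroup A B : subgroup (commutator_subgroup A B).
Proof.
split=> [|x y Hx Hy] H /= [sH AB]; first exact: sH.1.
by apply: sH.2; [apply: Hx | apply: Hy].
Qed.

Lemma mem_commutator A B x y : A x -> B y -> commutator_subgroup A B [~ x, y]%g.
Proof. by move=> Ax By H [sH]; apply; exists x => //; exists y. Qed.

Lemma commutator_subP A B H :
    subgroup H -> (forall x y, A x -> B y -> H [~ x, y]%g) ->
  commutator_subgroup A B `<=` H.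
Proof. by move=> sH AB; apply: smallest_sub => // _ [x Ax [y By <-]]; apply: AB. Qed.

Lemma commutator_sub A A' B B' : A `<=` A' -> B `<=` B' ->
  commutator_subgroup A B `<=` commutator_subgroup A' B'.
Proof.
move=> sA sB; apply: commutator_subP => [|x y Ax By]; first exact: commutator_is_subgroup.
by apply: mem_commutator; [apply: sA | apply: sB].
Qed.

Lemma commutator_normal A B : normal_subgroup A -> normal_subgroup B ->
  normal_subgroup (commutator_subgroup A B).
Proof.
move=> [_ nA] [_ nB]; split=> [|x g]; first exact: commutator_is_subgroup.
have sAB := commutator_is_subgroup A B.
apply: (@commutator_subP A B [set x | commutator_subgroup A B (x ^ g)%g]).
  split=> /= [|y z Hy Hz]; first by rewrite conj1g; apply: sAB.1.
  by rewrite conjMg conjVg; apply: sAB.2.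
by move=> y z Ay Bz /=; rewrite conjRg; apply: mem_commutator; [apply: nA | apply: nB].
Qed.

Lemma commutator_normal_sub A B : normal_subgroup A -> commutator_subgroup A B `<=` A.
Proof.
move=> [sA nA]; apply: commutator_subP => // x y Ax By.
by rewrite commgEl; apply: subgroupM => //; [apply: subgroupV | apply: nA].
Qed.

Lemma lower_central_normal R n : normal_subgroup R -> normal_subgroup (lower_central R n).
Proof.
move=> nR; rewrite /lower_central; elim: n.-1 => //= m IHm.
exact: commutator_normal.
Qed.

Lemma subset_mul_subgroup A B :
  subgroup A -> normal_subgroup B -> subgroup (subset_mul A B).
Proof.
move=> sA [sB nB]; split.
  by exists 1%g; [exact: sA.1 | exists 1%g; [exact: sB.1 | rewrite mulg1]].
move=> _ _ [a Aa [b Bb <-]] [a' Aa' [b' Bb' <-]].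
exists (a / a')%g; first exact: sA.2.
exists ((b / b') ^ a'^-1)%g; first by apply: nB; apply: sB.2.
by rewrite conjgE invgK invgM !mulgA mulgVK.
Qed.

(** The representative is chosen from the right coset R g as a set; when R is a subgroup the default
    1 is never reached, since g itself qualifies. *)
Definition coset_rep R (g : F) : F := xget 1%g [set y | R (g / y)%g].

Lemma coset_repP R g : subgroup R -> R (g / coset_rep R g)%g.
Proof.
move=> sR; rewrite /coset_rep; case: xgetP => [y -> //|/(_ g)].
by rewrite /= mulgV => /(_ sR.1).
Qed.

(** The candidates for g and for a g form the same set, and [xget] depends only on that set. *)
Lemma coset_repM R a g : subgroup R -> R a -> coset_rep R (a * g)%g = coset_rep R g.
Proof.
move=> sR Ra; rewrite /coset_rep; congr xget; apply/seteqP.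
split=> y /= Hy; last by rewrite -mulgA; apply: subgroupM.
by rewrite -[g](mulKg a) -mulgA; apply: subgroupM => //; apply: subgroupV.
Qed.

(** Dividing g by the representative of R g leaves an element of R, to which f applies; the result
    is equivariant under left multiplication by R. *)
Lemma hom_on_extend R M (f : F -> M) : subgroup R -> hom_on R f ->
  exists f' : F -> M, forall a g, R a -> f' (a * g)%g = f a + f' g.
Proof.
move=> sR fM; exists (fun g => f (g / coset_rep R g)%g) => a g Ra.
by rewrite coset_repM // -mulgA (fM a) //; apply: coset_repP.
Qed.

(** H/K is realized on the representatives [n x]. As K contains the commutators of H, factors may be
    exchanged modulo K, which makes the induced operation well defined and commutative. The
    projection q is extended by zero off H. *)
Lemma abelian_quotient H K : subgroup H -> subgroup K -> K `<=` H ->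
    (forall x y, H x -> H y -> K [~ x, y]%g) ->
  exists (Q : zmodType) (q : F -> Q) (rep : Q -> F),
    [/\ hom_on H q, forall x, H x -> q x = 0 -> K x, forall x, K x -> q x = 0,
        forall v, H (rep v) & cancel rep q].
Proof.
move=> sH sK sKH HK; pose n := coset_rep K.
have nHK x : H x -> exists2 k, K k & n x = (k * x)%g.
  move=> Hx; exists (n x / x)%g; last by rewrite mulgVK.
  by rewrite -invgF; apply: subgroupV => //; exact: (coset_repP _ sK).
have nH x : H x -> H (n x).
  by move=> Hx; have [k /sKH Hk ->] := nHK x Hx; apply: subgroupM.
have nK x k : K k -> n (k * x)%g = n x by move=> Kk; exact: coset_repM.
have nn x : H x -> n (n x) = n x.
  by move=> /nHK[k Kk nx]; rewrite [in LHS]nx nK.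
have nMl x y : H x -> n (n x * y)%g = n (x * y)%g.
  by move=> Hx; have [k Kk ->] := nHK x Hx; rewrite -mulgA (nK _ _ Kk).
have nC x y : H x -> H y -> n (x * y)%g = n (y * x)%g.
  move=> Hx Hy; have Kxy : K [~ x^-1, y^-1]%g by apply: HK; apply: subgroupV.
  by rewrite (commgCV x y) (nK _ _ Kxy).
pose T := {x : F | `[<H x>] && (n x == x)}.
have TH (u : T) : H (val u) by case/andP: (valP u) => /asboolP.
have Tn (u : T) : n (val u) = val u by case/andP: (valP u) => _ /eqP.
have qP x : H x -> `[<H (n x)>] && (n (n x) == n x).
  by move=> Hx; rewrite nn // eqxx andbT; apply/asboolP/nH.
pose q0 x (Hx : H x) : T := exist _ (n x) (qP x Hx).
have HM (u v : T) : H (val u * val v)%g by apply: subgroupM.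
have HV (u : T) : H ((val u)^-1)%g by apply: subgroupV.
pose add u v := q0 _ (HM u v).
pose opp u := q0 _ (HV u).
pose zero := q0 _ sH.1.
have addC : commutative add by move=> u v; apply: val_inj; apply: nC.
have addA : associative add.
  move=> u v w; apply: val_inj.
  change (n (val u * n (val v * val w))%g = n (n (val u * val v) * val w)%g).
  (* [nMl] absorbs a representative only in the left factor; on the other side [nC] first exchanges
     the factors. *)
  rewrite (nMl (val u * val v)%g) // nC ?nMl //; last exact: nH.
  by rewrite (nC _ (val u)) // mulgA.
have add0 : left_id zero add.
  by move=> u; apply: val_inj; apply: etrans (nMl _ _ sH.1) _; rewrite mul1g Tn.
have addN : left_inverse zero opp add.
  by move=> u; apply: val_inj; apply: etrans (nMl _ _ (HV u)) _; rewrite mulVg.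
pose Q : zmodType := HB.pack_for zmodType T (GRing.isZmodule.Build T addA addC add0 addN).
pose q x : Q := if pselect (H x) is left Hx then q0 x Hx else zero.
have qE x : H x -> val (q x : T) = n x by rewrite /q; case: pselect.
exists Q, q, (fun u : T => val u); split=> //.
- move=> x y Hx Hy; apply: (@val_inj _ _ T).
  rewrite qE /=; last exact: subgroupM.
  by rewrite !qE // nMl // nC 1?[RHS]nC ?nMl //; apply: nH.
- move=> x Hx /(congr1 (fun u : T => val u)); rewrite qE // => nx1.
  have nx : n x = n 1%g by [].
  have [k Kk nxE] := nHK x Hx.
  have [k' Kk'] := nHK 1%g sH.1; rewrite mulg1 -nx nxE => kx.
  by rewrite -[x](mulKg k) kx; apply: subgroupM => //; apply: subgroupV.
- move=> x Kx; apply: (@val_inj _ _ T); rewrite qE; last exact: sKH.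
  by rewrite -[x]mulg1; apply: nK.
- by move=> u; apply: (@val_inj _ _ T); rewrite qE ?Tn //; apply: TH.
Qed.

End SubgroupTheory.

(** * The group ring *)

Section AdditivelyClosed.
Variable V : zmodType.
Implicit Types (B : V -> Prop).

Definition zclosed B : Prop := B 0 /\ forall u v, B u -> B v -> B (u - v).

Lemma zclosedMz B u (c : int) : zclosed B -> B u -> B (u *~ c).
Proof.
move=> [B0 BB] Bu; have BN v : B v -> B (- v) by move=> Bv; rewrite -sub0r; apply: BB.
have BMn n : B (u *+ n).
  elim: n => [|n IHn] //; rewrite mulrSr -[X in _ + X]opprK; apply: BB => //; exact: BN.
by case: c => n; rewrite ?NegzE ?mulrNz; [|apply: BN]; apply: BMn.
Qed.

Lemma zclosedD B u v : zclosed B -> B u -> B v -> B (u + v).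
Proof.
move=> sB Bu Bv; rewrite -[v]opprK; apply: sB.2 => //.
by rewrite -mulrN1z; apply: zclosedMz.
Qed.

Lemma ker_zclosed (M : zmodType) (f : V -> M) : zmod_morphism f -> zclosed (fun v => f v = 0).
Proof.
move=> fB; split=> [|u v fu fv]; last by rewrite fB fu fv subrr.
by rewrite -[0 in LHS](subrr 0) fB subrr.
Qed.

End AdditivelyClosed.

Lemma zmod_morphismD (U V : zmodType) (f : U -> V) :
  zmod_morphism f -> {morph f : u v / u + v}.
Proof.
move=> fB u v; have f0 : f 0 = 0 by rewrite -[0 in LHS](subrr 0) fB subrr.
by rewrite -[v in LHS]opprK fB -[- v]sub0r fB f0 sub0r opprK.
Qed.

Section LinearExtension.
Variables (K : choiceType) (A : zmodType) (f : K -> A).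
Local Open Scope fset_scope.

Definition lin (u : {malg int[K]}) : A := \sum_(x <- msupp u) f x *~ u@_x.

Lemma linEw (d : {fset K}) (u : {malg int[K]}) :
  msupp u `<=` d -> lin u = \sum_(x <- d) f x *~ u@_x.
Proof.
move=> le_ud; rewrite /lin (big_fset_incl _ le_ud) //= => x _ /mcoeff_outdom ->.
by rewrite mulr0z.
Qed.

Lemma linU c x : lin << c *g x >> = f x *~ c.
Proof. by rewrite (linEw msuppU_le) big_seq_fset1 mcoeffUU. Qed.

Lemma linB : zmod_morphism lin.
Proof.
move=> u v; rewrite (linEw (msuppB_le u v)) (linEw (fsubsetUl (msupp u) (msupp v))).
rewrite (linEw (fsubsetUr (msupp u) (msupp v))) -sumrB.
by apply: eq_bigr => x _; rewrite mcoeffB mulrzBr.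
Qed.

HB.instance Definition _ := GRing.isZmodMorphism.Build {malg int[K]} A lin linB.

End LinearExtension.

Section AdditiveSubgroups.
Variable F : groupType.
Implicit Types (A B C : set (group_ring F)) (H : set F) (u v w : group_ring F).

Lemma additive_subgroupD A u v : additive_subgroup A -> A u -> A v -> A (u + v).
Proof. exact: zclosedD. Qed.

Lemma additive_subgroupMz A u (c : int) : additive_subgroup A -> A u -> A (u *~ c).
Proof. exact: zclosedMz. Qed.

Lemma gr_sumE u : u = \sum_(x <- msupp u) gr_of x *~ u@_x.
Proof.
rewrite {1}[u]monalgE; apply: eq_bigr => x _.
by rewrite /gr_of -[u@_x in LHS]intz -raddfMz.
Qed.

Lemma gr_linB (M : zmodType) (f : F -> M) : zmod_morphism (lin f : group_ring F -> M).
Proof. exact: linB. Qed.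

Lemma lin_gr_of (M : zmodType) (f : F -> M) x : lin f (gr_of x) = f x.
Proof. by rewrite linU. Qed.

Lemma gr_supp_ind A H u : additive_subgroup A -> (forall x, H x -> A (gr_of x)) ->
  (forall x, x \in msupp u -> H x) -> A u.
Proof.
move=> sA AH Hu; rewrite [u]gr_sumE big_seq; elim/big_ind: _ => [|v w|x xu].
- exact: sA.1.
- exact: additive_subgroupD.
by apply: additive_subgroupMz => //; apply: AH; apply: Hu.
Qed.

Lemma gr_ind A u : additive_subgroup A -> (forall x, A (gr_of x)) -> A u.
Proof. by move=> sA AF; apply: (@gr_supp_ind A setT). Qed.

Lemma equalizer_additive (M : zmodType) (f g : group_ring F -> M) :
  zmod_morphism f -> zmod_morphism g -> additive_subgroup [set u | f u = g u].
Proof.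
move=> fB gB; split=> /= [|u v fgu fgv]; last by rewrite fB gB fgu fgv.
by rewrite -[0](subrr 0) fB gB !subrr.
Qed.

Lemma gr_lin_ext (M : zmodType) (f g : group_ring F -> M) :
    zmod_morphism f -> zmod_morphism g ->
  (forall x, f (gr_of x) = g (gr_of x)) -> f =1 g.
Proof. by move=> fB gB fg u; apply: (gr_ind u (equalizer_additive fB gB)). Qed.

Lemma smallest_additive (D : set (group_ring F)) :
  additive_subgroup (smallest (@additive_subgroup F) D).
Proof.
split=> [|u v Du Dv] A [sA DA]; first exact: sA.1.
by apply: sA.2; [apply: Du | apply: Dv].
Qed.

(* Z[H] as a subset of Z[F]. *)
Definition gr_span H : set (group_ring F) := smallest (@additive_subgroup F) (@gr_of F @` H).

Lemma gr_span_of H x : H x -> gr_span H (gr_of x).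
Proof. by move=> Hx A [_]; apply; exists x. Qed.

Lemma gr_spanP H A : additive_subgroup A -> (forall x, H x -> A (gr_of x)) ->
  gr_span H `<=` A.
Proof. by move=> sA HA; apply: smallest_sub => // _ [x Hx <-]; apply: HA. Qed.

Lemma gr_spanM H u v : subgroup H -> gr_span H u -> gr_span H v -> gr_span H (u * v).
Proof.
move=> sH Hu Hv; have sS := smallest_additive (@gr_of F @` H).
move: u Hu; apply: gr_spanP => [|x Hx].
  split=> [|u w Hu Hw]; first by rewrite /= mul0r; apply: sS.1.
  by rewrite /= mulrBl; apply: sS.2.
move: v Hv; apply: gr_spanP => [|y Hy].
  split=> [|u w Hu Hw]; first by rewrite /= mulr0; apply: sS.1.
  by rewrite /= mulrBr; apply: sS.2.
by rewrite -gr_ofM; apply: gr_span_of; apply: subgroupM.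
Qed.

(** The anti-involution of Z[F] extending inversion. It exchanges left and right, so that crossed
    homomorphisms built for left factors also serve for right factors. *)
Definition gr_star : group_ring F -> group_ring F := lin (fun x => gr_of x^-1%g).

Lemma gr_starB : zmod_morphism gr_star. Proof. exact: linB. Qed.

Lemma gr_star_of x : gr_star (gr_of x) = gr_of x^-1%g. Proof. exact: lin_gr_of. Qed.

Lemma gr_starM u v : gr_star (u * v) = gr_star v * gr_star u.
Proof.
apply: (@gr_lin_ext _ (fun u => gr_star (u * v)) (fun u => gr_star v * gr_star u))
  => [a b|a b|x]; rewrite ?mulrBl ?gr_starB ?mulrBr //.
apply: (@gr_lin_ext _ (fun v => gr_star (gr_of x * v)) (fun v => gr_star v * gr_star (gr_of x)))
  => [a b|a b|y]; rewrite ?mulrBr ?gr_starB ?mulrBl //.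
by rewrite -gr_ofM !gr_star_of -gr_ofM invgM.
Qed.

Lemma gr_starK : involutive gr_star.
Proof.
apply: (@gr_lin_ext _ (fun u => gr_star (gr_star u)) id) => [a b|//|x]; rewrite ?gr_starB //.
by rewrite !gr_star_of invgK.
Qed.

Lemma gr_span_star H u : subgroup H -> gr_span H u -> gr_span H (gr_star u).
Proof.
move=> sH; move: u; have sS := smallest_additive (@gr_of F @` H).
apply: gr_spanP => [|x Hx]; last by rewrite /= gr_star_of; apply: gr_span_of; apply: subgroupV.
split=> [|u v Hu Hv]; last by rewrite /= gr_starB; apply: sS.2.
by rewrite /= [gr_star 0]raddf0; apply: sS.1.
Qed.

(** The augmentation once more, as a linear extension, so that additivity comes for free. *)
Definition gr_eps : group_ring F -> int := lin (fun=> 1).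

Lemma gr_epsB : zmod_morphism gr_eps. Proof. exact: linB. Qed.

Lemma gr_epsD : {morph gr_eps : u v / u + v}. Proof. exact: raddfD. Qed.

Lemma gr_epsMz u c : gr_eps (u *~ c) = gr_eps u *~ c. Proof. exact: raddfMz. Qed.

Lemma gr_eps_of x : gr_eps (gr_of x) = 1. Proof. exact: lin_gr_of. Qed.

Lemma gr_epsE u : gr_eps u = augmentation u.
Proof. by apply: eq_bigr => x _; rewrite intz. Qed.

Lemma gr_epsM u v : gr_eps (u * v) = gr_eps u * gr_eps v.
Proof.
apply: (@gr_lin_ext _ (fun u => gr_eps (u * v)) (fun u => gr_eps u * gr_eps v))
  => [a b|a b|x]; rewrite ?mulrBl ?gr_epsB ?mulrBl //.
apply: (@gr_lin_ext _ (fun v => gr_eps (gr_of x * v)) (fun v => gr_eps (gr_of x) * gr_eps v))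
  => [a b|a b|y]; rewrite ?mulrBr ?gr_epsB ?mulrBr //.
by rewrite -gr_ofM !gr_eps_of.
Qed.

Lemma gr_eps_star u : gr_eps (gr_star u) = gr_eps u.
Proof.
apply: (@gr_lin_ext _ (fun u => gr_eps (gr_star u)) gr_eps) => [a b|a b|x].
- by rewrite gr_starB gr_epsB.
- exact: gr_epsB.
by rewrite gr_star_of !gr_eps_of.
Qed.

End AdditiveSubgroups.

(** * Homomorphisms and functionals *)

Section FreeGroups.
Variables (F : groupType) (X : Type) (i : X -> F).
Hypothesis freeF : free_on i.
Implicit Types (R N H : set F).

(* A word g in N traces a loop in the Schreier graph of N; if it crosses each edge
   a total of 0 times, then g is a product of commutators of elements of N. *)
Lemma hom_separation N g : subgroup N -> N g ->
  (forall f : F -> int, hom_on N f -> f g = 0) -> commutator_subgroup N N g.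
Proof.
move=> sN Ng fg0.
(* h counts, for a path from 1 to k, the signed crossings of each edge of the Schreier graph, an
   edge being a pair of a coset representative and a generator. *)
have [h h1 hX] := potential freeF
  (fun x k => << 1 *g (coset_rep N k, i x) >> : {malg int[(F * F)%type]}).
have hM a : N a -> forall k, h (a * k)%g = h a + h k.
  move=> Na; apply: (free_ind freeF) => [|k x]; first by rewrite mulg1 h1 addr0.
  by rewrite mulgA !hX coset_repM // addrA; split=> [->|/addIr].
(* By [hM] each coefficient of h is a homomorphism N -> Z, so the hypothesis makes it vanish at
   g. *)
have hg0 : h g = 0.
  apply/malgP => e; rewrite mcoeff0.
  by apply: (fg0 (fun k => (h k)@_e)) => x y Nx Ny; rewrite hM // mcoeffD.
have sN' := commutator_is_subgroup N N.
have [|x y Nx Ny|Q [q [rep [qM q0 _ _ _]]]] := abelian_quotient sN sN'.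
- by apply: commutator_subP => // x y; apply: subgroupR.
- exact: mem_commutator.
have [q' q'M] := hom_on_extend sN qM.
(* Summing the increments of q' over the crossed edges recovers q'. The increment along k -> k x
   depends only on the coset N k, because q' is N-equivariant. *)
have q'h : forall k, lin (fun e => q' (e.1 * e.2)%g - q' e.1) (h k) = q' k - q' 1%g.
  apply: (free_ind freeF) => [|k x]; first by rewrite h1 raddf0 subrr.
  rewrite hX raddfD /= linU /=.
  set t := coset_rep N k; have Nkt : N (k / t)%g by apply: coset_repP.
  have -> : q' (t * i x)%g - q' t = q' (k * i x)%g - q' k.
    rewrite -[k](mulgVK t) -mulgA !(q'M _ _ Nkt).
    by rewrite opprD addrACA subrr add0r.
  have -> : q' (k * i x)%g - q' 1%g = (q' k - q' 1%g) + (q' (k * i x)%g - q' k).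
    by rewrite [RHS]addrC subrKA.
  by rewrite mulr1z; split=> [->|/addIr].
apply: q0 => //; have := q'h g; rewrite hg0 raddf0 -{1}[g]mulg1 q'M //.
by rewrite addrK.
Qed.

(* The potential h jumps along the edge k -> k x by f' (k x) - f' k times an element of R,
   so that its augmentation is f' up to a constant. *)
Lemma crossed_lift R (f : F -> int) : subgroup R -> hom_on R f ->
  exists d : F -> group_ring F,
    [/\ forall a g, R a -> d (a * g)%g = d a * gr_of g + d g,
        forall a, R a -> gr_span R (d a) & forall a, R a -> gr_eps (d a) = f a].
Proof.
move=> sR fM; have [f' f'M] := hom_on_extend sR fM.
(* The element of R is the representative of R k x divided by k x. Replacing k by a k multiplies it
   by a^-1 on the right, which yields [hM]. *)
pose m x k := gr_of (coset_rep R (k * i x)%g * (k * i x)^-1)%g *~ (f' (k * i x)%g - f' k).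
have [h h1 hX] := potential freeF m.
have sS := smallest_additive (@gr_of F @` R).
have hR : forall k, gr_span R (h k).
  apply: (free_ind freeF) => [|k x]; first by rewrite h1; apply: sS.1.
  have Rm : gr_span R (m x k).
    rewrite /m; apply: (additive_subgroupMz _ sS); apply: gr_span_of.
    by rewrite -invgF; apply: subgroupV => //; apply: coset_repP.
  rewrite hX; split=> Hh; first exact: (additive_subgroupD sS).
  by rewrite -[h k](addrK (m x k)); apply: sS.2.
have heps : forall k, gr_eps (h k) = f' k - f' 1%g.
  apply: (free_ind freeF) => [|k x]; first by rewrite h1 subrr [LHS]raddf0.
  rewrite hX gr_epsD /m gr_epsMz gr_eps_of.
  have -> : f' (k * i x)%g - f' 1%g = (f' k - f' 1%g) + (f' (k * i x)%g - f' k).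
    by rewrite [RHS]addrC subrKA.
  by rewrite intz; split=> [->|/addIr].
have hM a : R a -> forall k, h (a * k)%g = h a + h k * gr_of (a^-1)%g.
  move=> Ra; apply: (free_ind freeF) => [|k x]; first by rewrite h1 mul0r mulg1 addr0.
  have mM : m x (a * k)%g = m x k * gr_of a^-1%g.
    rewrite /m -(mulgA a) (coset_repM _ sR Ra) (f'M a (k * i x)%g Ra) (f'M a k Ra).
    rewrite opprD addrACA subrr add0r.
    by rewrite mulrzAl -gr_ofM invgM mulgA.
  by rewrite mulgA !hX mM mulrDl addrA; split=> [->|/addIr].
(* Multiplying by g on the right turns h (a g) = h a + h g a^-1 into the crossed law d (a g) = d a g
   + d g. *)
exists (fun g => h g * gr_of g); split=> [a g Ra|a Ra|a Ra].
- have aK : gr_of a^-1%g * gr_of (a * g)%g = gr_of g by rewrite -gr_ofM mulKg.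
  by rewrite hM // mulrDl -[X in _ + X]mulrA aK gr_ofM mulrA.
- by apply: (gr_spanM sR (hR a)); apply: gr_span_of.
by rewrite gr_epsM gr_eps_of mulr1 heps -{1}[a]mulg1 f'M // addrK.
Qed.

(* Since Delta(R) is projective, Delta(R) (x) Z[F] (x) Delta(R) -> Z[F] can be
   inverted enough to extend  (a - 1) w (c - 1) |-> C (d a * w * d' c)  to Z[F]. *)
Lemma sandwich_functional R (f1 f2 : F -> int) (C : group_ring F -> int) :
    subgroup R -> hom_on R f1 -> hom_on R f2 -> zmod_morphism C ->
  exists (L : group_ring F -> int) (d d' : F -> group_ring F),
    [/\ zmod_morphism L,
        forall a c w, R a -> R c ->
          L ((gr_of a - 1) * w * (gr_of c - 1)) = C (d a * w * d' c),
        forall a, R a -> gr_span R (d a) /\ gr_eps (d a) = f1 a &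
        forall c, R c -> gr_span R (d' c) /\ gr_eps (d' c) = f2 c].
Proof.
move=> sR f1M f2M CB.
have [d [dM dR deps]] := crossed_lift sR f1M.
(* The sign cancels against the inverse of c in the definition of d' c. *)
have f2N : hom_on R (fun x => - f2 x) by move=> x y Rx Ry; rewrite f2M // opprD.
have [e [eM eR eeps]] := crossed_lift sR f2N.
have linM (p : F -> group_ring F) :
    (forall a g, R a -> p (a * g)%g = p a * gr_of g + p g) ->
  forall a w, R a -> lin p ((gr_of a - 1) * w) = p a * w.
  move=> pM a w Ra.
  apply: (@gr_lin_ext _ _ (fun w => lin p ((gr_of a - 1) * w)) (fun w => p a * w))
    => [u v|u v|x]; rewrite ?mulrBr ?gr_linB //.
  by rewrite mulrBl mul1r -gr_ofM gr_linB !lin_gr_of pM // addrK.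
(* The extension of d replaces the left factor a - 1 by d a; the extension of e, conjugated by the
   anti-involution, replaces the right factor c - 1 by d' c. *)
exists (fun u => C (gr_star (lin e (gr_star (lin d u))))), d,
  (fun c => gr_star (e c^-1%g)); split=> [u v|a c w Ra Rc|a Ra|c Rc].
- by rewrite gr_linB gr_starB gr_linB gr_starB CB.
- have Rc' : R c^-1%g by apply: subgroupV.
  rewrite -mulrA linM // mulrA gr_starM gr_starB gr_star_of.
  have -> : gr_star 1 = 1 :> group_ring F by rewrite -[1]gr_of1 gr_star_of invg1.
  by rewrite linM // gr_starM gr_starK.
- by rewrite deps //; split=> //; apply: dR.
have Rc' : R c^-1%g by apply: subgroupV.
split; first by apply: gr_span_star => //; apply: eR.
by rewrite gr_eps_star eeps // (hom_onV sR f2M) // opprK.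
Qed.

End FreeGroups.

(** * Products of ideals, relative augmentation ideals and their dimension subgroups *)

Section Ideals.
Variable F : groupType.
Implicit Types (A B C I J : set (group_ring F)) (H R S : set F) (u v w : group_ring F).

Definition ideal I : Prop :=
  additive_subgroup I /\ forall u v, I u -> I (v * u) /\ I (u * v).

Lemma idealMl I u v : ideal I -> I u -> I (v * u).
Proof. by move=> [_ iI] Iu; have [] := iI u v Iu. Qed.

Lemma idealMr I u v : ideal I -> I u -> I (u * v).
Proof. by move=> [_ iI] Iu; have [] := iI u v Iu. Qed.

Lemma ker_additive (M : zmodType) (L : group_ring F -> M) :
  zmod_morphism L -> additive_subgroup [set u | L u = 0].
Proof. exact: ker_zclosed. Qed.

Lemma mem_ideal_mul A B u v : A u -> B v -> (A ** B) (u * v).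
Proof. by move=> Au Bv I [_]; apply; exists u => //; exists v. Qed.

Lemma ideal_mul_subP A B I : additive_subgroup I ->
  (forall u v, A u -> B v -> I (u * v)) -> A ** B `<=` I.
Proof. by move=> sI AB; apply: smallest_sub => // _ [u Au [v Bv <-]]; apply: AB. Qed.

Lemma ideal_mul_additive A B : additive_subgroup (A ** B).
Proof. exact: smallest_additive. Qed.

Lemma ideal_mulS A A' B B' : A `<=` A' -> B `<=` B' -> A ** B `<=` A' ** B'.
Proof.
move=> sA sB; apply: ideal_mul_subP => [|u v Au Bv]; first exact: ideal_mul_additive.
by apply: mem_ideal_mul; [apply: sA | apply: sB].
Qed.

Lemma preim_mull_additive u I :
  additive_subgroup I -> additive_subgroup [set v | I (u * v)].
Proof.
move=> [I0 IB]; split=> [|v w Iv Iw]; first by rewrite /= mulr0.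
by rewrite /= mulrBr; apply: IB.
Qed.

Lemma preim_mulr_additive v I :
  additive_subgroup I -> additive_subgroup [set u | I (u * v)].
Proof.
move=> [I0 IB]; split=> [|u w Iu Iw]; first by rewrite /= mul0r.
by rewrite /= mulrBl; apply: IB.
Qed.

Lemma ideal_mulA A B C : A ** B ** C = A ** (B ** C).
Proof.
apply/seteqP; split.
  apply: ideal_mul_subP => [|u w ABu Cw]; first exact: ideal_mul_additive.
  move: u ABu; apply: (@ideal_mul_subP A B [set u | (A ** (B ** C)) (u * w)]) => [|u v Au Bv].
    exact/preim_mulr_additive/ideal_mul_additive.
  by rewrite /= -mulrA; do 2![apply: mem_ideal_mul => //].
apply: ideal_mul_subP => [|u w Au BCw]; first exact: ideal_mul_additive.
move: w BCw; apply: (@ideal_mul_subP B C [set w | (A ** B ** C) (u * w)]) => [|v w Bv Cw].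
  exact/preim_mull_additive/ideal_mul_additive.
by rewrite /= mulrA; do 2![apply: mem_ideal_mul => //].
Qed.

Lemma ideal_mul_ideal I J : ideal I -> ideal J -> ideal (I ** J).
Proof.
move=> iI iJ; have sIJ := ideal_mul_additive I J.
split=> // u v IJu; split; move: u IJu.
  apply: (@ideal_mul_subP _ _ [set u | (I ** J) (v * u)]) => [|u w Iu Jw].
    exact: preim_mull_additive.
  by rewrite /= mulrA; apply: mem_ideal_mul => //; apply: idealMl.
apply: (@ideal_mul_subP _ _ [set u | (I ** J) (u * v)]) => [|u w Iu Jw].
  exact: preim_mulr_additive.
by rewrite /= -mulrA; apply: mem_ideal_mul => //; apply: idealMr.
Qed.

Lemma ideal_mul_subl I J : ideal I -> I ** J `<=` I.
Proof.
by move=> iI; apply: ideal_mul_subP => [|u v Iu _]; [apply: iI.1 | apply: idealMr].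
Qed.

Lemma ideal_mul_subr I J : ideal J -> I ** J `<=` J.
Proof.
by move=> iJ; apply: ideal_mul_subP => [|u v _ Ju]; [apply: iJ.1 | apply: idealMl].
Qed.

Lemma mem_aug_ideal H h : H 1%g -> H h -> aug_ideal H (gr_of h - 1).
Proof.
move=> H1 Hh; split=> [x xh|]; last by rewrite -gr_epsE gr_epsB -[1]gr_of1 !gr_eps_of subrr.
have : x \in (msupp (gr_of h) `|` msupp (gr_of (1 : F)%g))%fset.
  by apply: fsubsetP xh; apply: msuppB_le.
by rewrite inE /gr_of !msuppU oner_eq0 !inE => /orP[] /eqP->.
Qed.

(** For any u supported on H, the difference of u and its augmentation is an integral combination of
    the elements h - 1. *)
Lemma aug_ideal_subP H A : additive_subgroup A ->
  (forall h, H h -> A (gr_of h - 1)) -> aug_ideal H `<=` A.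
Proof.
move=> sA HA u [Hu]; rewrite -gr_epsE => eu.
suff : A (u - 1 *~ gr_eps u) by rewrite eu mulr0z subr0.
apply: (@gr_supp_ind F [set u | A (u - 1 *~ gr_eps u)] H) => // [|x Hx].
  split=> [|v w /= Av Aw].
    by rewrite /= [gr_eps 0]raddf0 mulr0z subr0; apply: sA.1.
  rewrite gr_epsB mulrzBr opprD opprK addrACA -[X in _ + X]opprK opprD opprK.
  exact: sA.2.
by rewrite /= gr_eps_of; apply: HA.
Qed.

Lemma aug_ideal_setTP u : aug_ideal setT u <-> gr_eps u = 0.
Proof. by rewrite gr_epsE; split=> [[]|]. Qed.

Lemma aug_ideal_ideal : ideal (@aug_ideal F setT).
Proof.
split=> [|u v /aug_ideal_setTP eu].
  split=> [|u v /aug_ideal_setTP eu /aug_ideal_setTP ev]; apply/aug_ideal_setTP.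
    exact: raddf0.
  by rewrite gr_epsB eu ev subrr.
by split; apply/aug_ideal_setTP; rewrite gr_epsM eu ?mulr0 ?mul0r.
Qed.

Lemma rel_ideal_subP H A : additive_subgroup A ->
  (forall h w, H h -> A ((gr_of h - 1) * w)) -> rel_ideal H `<=` A.
Proof.
move=> sA HA; apply: ideal_mul_subP => // u w; move: u.
apply: (@aug_ideal_subP _ [set u | setT w -> A (u * w)]) => [|h Hh _]; last exact: HA.
split=> [_|u v Au Av _]; first by rewrite mul0r; apply: sA.1.
by rewrite mulrBl; apply: sA.2; [apply: Au | apply: Av].
Qed.

Lemma mem_rel_ideal H h : H 1%g -> H h -> rel_ideal H (gr_of h - 1).
Proof.
by move=> H1 Hh; rewrite -[_ - _]mulr1; apply: mem_ideal_mul => //; apply: mem_aug_ideal.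
Qed.

(** Moves a generator h - 1 across a group element. For normal H this makes the ideal two-sided and
    lets its generators be written on either side. *)
Lemma gr_of_conj h x : (gr_of h - 1) * gr_of x = gr_of x * (gr_of (h ^ x)%g - 1) :> group_ring F.
Proof. by rewrite mulrBl mulrBr mul1r mulr1 -!gr_ofM conjgC. Qed.

Lemma rel_ideal_subPr H A : normal_subgroup H -> additive_subgroup A ->
  (forall h w, H h -> A (w * (gr_of h - 1))) -> rel_ideal H `<=` A.
Proof.
move=> [_ nH] sA HA; apply: rel_ideal_subP => // h w Hh; move: w.
move=> w; apply: (@gr_ind _ [set w | A ((gr_of h - 1) * w)]) => [|x].
  exact: preim_mull_additive.
by rewrite /= gr_of_conj; apply: HA; apply: nH.
Qed.

Lemma rel_ideal_ideal H : normal_subgroup H -> ideal (rel_ideal H).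
Proof.
move=> [sH nH]; have sr : additive_subgroup (rel_ideal H) by apply: ideal_mul_additive.
have rM u v : rel_ideal H u -> rel_ideal H (u * v).
  move: u; apply: (@rel_ideal_subP H [set u | rel_ideal H (u * v)]) => [|h w Hh].
    exact: preim_mulr_additive.
  by rewrite /= -mulrA; apply: mem_ideal_mul => //; apply: mem_aug_ideal => //; apply: sH.1.
split=> // u v Hu; split; last exact: rM.
move: u Hu v; apply: (@rel_ideal_subP H [set u | forall v, rel_ideal H (v * u)]).
  split=> [|u w Hu Hw] v; first by rewrite mulr0; apply: sr.1.
  by rewrite mulrBr; apply: sr.2; [apply: Hu | apply: Hw].
move=> h w Hh v; apply: (@gr_ind _ [set v | rel_ideal H (v * ((gr_of h - 1) * w))]) => [|x].
  exact: preim_mulr_additive.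
rewrite /= mulrA; apply: (rM (gr_of x * (gr_of h - 1))).
rewrite -{1}[h](conjgKV x) -gr_of_conj; apply: rM.
by apply: mem_rel_ideal; [apply: sH.1 | apply: nH].
Qed.

Lemma rel_idealS R S : R `<=` S -> rel_ideal R `<=` rel_ideal S.
Proof.
move=> RS; apply: ideal_mulS => // u [uR eu]; split=> // x /uR; exact: RS.
Qed.

Lemma rel_ideal_aug H : rel_ideal H `<=` aug_ideal setT.
Proof.
apply: rel_ideal_subP => [|h w _]; first exact: aug_ideal_ideal.1.
by apply: idealMr; [exact: aug_ideal_ideal | apply: mem_aug_ideal].
Qed.

Lemma dimension_subgroup_subgroup I : ideal I -> subgroup (dimension_subgroup I).
Proof.
move=> iI; split=> [|x y Ix Iy].
  by rewrite /dimension_subgroup /= gr_of1 subrr; apply: iI.1.1.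
rewrite /dimension_subgroup /=.
have -> : gr_of (x / y)%g - 1 = (gr_of x - 1 - (gr_of y - 1)) * gr_of (y^-1)%g.
  by rewrite opprB addrA subrK mulrBl -!gr_ofM mulgV.
by apply: idealMr => //; apply: iI.1.2.
Qed.

(** The second factor equals xy - yx, and x^-1 y^-1 (xy - yx) = [x, y] - 1. *)
Lemma gr_of_commg (x y : F) : gr_of [~ x, y]%g - 1 =
  gr_of (x^-1 * y^-1)%g * ((gr_of x - 1) * (gr_of y - 1) - (gr_of y - 1) * (gr_of x - 1)).
Proof.
have -> : (gr_of x - 1) * (gr_of y - 1) - (gr_of y - 1) * (gr_of x - 1)
    = gr_of (x * y)%g - gr_of (y * x)%g.
  rewrite !mulrBl !mulrBr !mul1r !mulr1 -!gr_ofM -!(addrA _ (- _) (- _)) -!opprD.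
  rewrite [gr_of y + (gr_of x - 1)]addrCA [X in _ - X]addrCA [- (gr_of x + _)]opprD.
  by rewrite [_ + (- gr_of x + _)]addrCA subrr addr0 opprB subrKA.
rewrite mulrBr -!gr_ofM; congr (_ - _); first by rewrite /commg /conjg !mulgA.
by rewrite mulgA mulgVK mulVg.
Qed.

Lemma commutator_dimension (X Y : set F) I : ideal I ->
    (forall x y, X x -> Y y -> I ((gr_of x - 1) * (gr_of y - 1))) ->
    (forall x y, X x -> Y y -> I ((gr_of y - 1) * (gr_of x - 1))) ->
  commutator_subgroup X Y `<=` dimension_subgroup I.
Proof.
move=> iI XY YX; apply: commutator_subP => [|x y Xx Yy].
  exact: dimension_subgroup_subgroup.
rewrite /dimension_subgroup /= gr_of_commg; apply: idealMl => //.
by apply: iI.1.2; [apply: XY | apply: YX].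
Qed.

(* The power [rel_ideal R ^ n.+1]. *)
Definition rel_pow R n : set (group_ring F) := iter n (fun I => I ** rel_ideal R) (rel_ideal R).

Lemma rel_pow_ideal R n : normal_subgroup R -> ideal (rel_pow R n).
Proof.
move=> nR; elim: n => [|n IHn]; first exact: rel_ideal_ideal.
by apply: ideal_mul_ideal => //; apply: rel_ideal_ideal.
Qed.

Lemma rel_powSr R n : rel_ideal R ** rel_pow R n = rel_pow R n.+1.
Proof. by elim: n => //= n IHn; rewrite -ideal_mulA IHn. Qed.

Lemma lower_central_dimension R n : normal_subgroup R ->
  lower_central R n.+1 `<=` dimension_subgroup (rel_pow R n).
Proof.
move=> nR; elim: n => [|n IHn]; first by move=> x Rx; apply: mem_rel_ideal => //; apply: nR.1.1.
apply: commutator_dimension => [|x y /IHn Ix Ry|x y /IHn Ix Ry].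
- exact: rel_pow_ideal.
- by apply: mem_ideal_mul => //; apply: mem_rel_ideal => //; apply: nR.1.1.
by rewrite -rel_powSr; apply: mem_ideal_mul => //; apply: mem_rel_ideal => //; apply: nR.1.1.
Qed.

End Ideals.

(** * Functionals on Z[F] that vanish on products r I r *)

Section Functionals.
Variables (F : groupType) (X : Type) (i : X -> F).
Hypothesis freeF : free_on i.
Implicit Types (R S : set F) (I : set (group_ring F)).

(** The product is spanned by elements (h - 1) w (k - 1) with h, k in R and w in I, on which L takes
    the value C (d h * w * d' k), with argument in I. *)
Lemma sandwich_kills R I (L C : group_ring F -> int) (d d' : F -> group_ring F) :
    normal_subgroup R -> ideal I -> zmod_morphism L ->
    (forall a c w, R a -> R c -> L ((gr_of a - 1) * w * (gr_of c - 1)) = C (d a * w * d' c)) ->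
    (forall u, I u -> C u = 0) ->
  forall u, (rel_ideal R ** I ** rel_ideal R) u -> L u = 0.
Proof.
move=> nR iI LB LE CI; have sL := ker_additive LB.
rewrite ideal_mulA; apply: (ideal_mul_subP sL) => u v; move: u.
apply: rel_ideal_subP => [|h w Rh] /=.
  split=> [|u w Hu Hw Iv]; first by rewrite mul0r sL.1.
  by rewrite mulrBl; apply: sL.2; [apply: Hu | apply: Hw].
have sLw := preim_mull_additive ((gr_of h - 1) * w) sL.
move: v; apply: (ideal_mul_subP sLw) => u v Iu; move: v.
apply: (rel_ideal_subPr nR (preim_mull_additive u sLw)) => k v Rk.
rewrite /=; have -> : (gr_of h - 1) * w * (u * (v * (gr_of k - 1)))
    = (gr_of h - 1) * (w * (u * v)) * (gr_of k - 1) by rewrite !mulrA.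
rewrite /= LE //; apply: CI.
exact: idealMr _ iI (idealMl _ iI (idealMl _ iI (idealMr _ iI Iu))).
Qed.

(** Take for C the augmentation, which kills Delta(F) and sends d a and d' b to f1 a and f2 b. *)
Lemma bilinear_functional R (f1 f2 : F -> int) :
    normal_subgroup R -> hom_on R f1 -> hom_on R f2 ->
  exists L : group_ring F -> int,
    [/\ zmod_morphism L,
        forall u, (rel_ideal R ** aug_ideal setT ** rel_ideal R) u -> L u = 0 &
        forall a b, R a -> R b -> L ((gr_of a - 1) * (gr_of b - 1)) = f1 a * f2 b].
Proof.
move=> nR f1M f2M.
have [L [d [d' [LB LE dE d'E]]]] := sandwich_functional freeF nR.1 f1M f2M (@gr_epsB F).
exists L; split=> // [|a b Ra Rb].
  apply: (sandwich_kills nR _ LB LE); first exact: aug_ideal_ideal.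
  by move=> u /aug_ideal_setTP.
rewrite -[gr_of a - 1]mulr1 LE // mulr1 gr_epsM.
by have [_ ->] := dE a Ra; have [_ ->] := d'E b Rb.
Qed.

(** The condition under which a sandwich functional becomes a product f1 a * f b * f3 c: the outer
    factors d a and d' c lie in Z[R] and then contribute only their augmentations. *)
Definition middle_form R (f : F -> int) (C : group_ring F -> int) : Prop :=
  zmod_morphism C /\ forall x b y, R x -> R b -> R y ->
    C (gr_of x * (gr_of b - 1) * gr_of y) = f b.

Lemma middle_formE R f C u b v : middle_form R f C ->
    gr_span R u -> R b -> gr_span R v ->
  C (u * (gr_of b - 1) * v) = gr_eps u * f b * gr_eps v.
Proof.
move=> [CB CE] Ru Rb; move: u Ru v.
apply: (@gr_spanP F R [set u | forall v, gr_span R v -> _ = _]) => [|x Rx v].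
  split=> [v _|u w Hu Hw v Rv] /=.
    rewrite !mul0r [gr_eps 0]raddf0 !mul0r; apply: (ker_additive CB).1.
  rewrite (mulrBl (gr_of b - 1)) (mulrBl v) CB (Hu v Rv) (Hw v Rv).
  by rewrite gr_epsB -!mulrA -mulrBl.
apply: (@gr_spanP F R [set v | _ = _]) => [|y Ry]; last by rewrite /= CE // !gr_eps_of mul1r mulr1.
apply: equalizer_additive => u w; first by rewrite mulrBr CB.
by rewrite gr_epsB mulrBr.
Qed.

Lemma trilinear_functional R I (f1 f2 f3 : F -> int) C :
    normal_subgroup R -> hom_on R f1 -> hom_on R f3 -> ideal I ->
    middle_form R f2 C -> (forall u, I u -> C u = 0) ->
  exists L : group_ring F -> int,
    [/\ zmod_morphism L,
        forall u, (rel_ideal R ** I ** rel_ideal R) u -> L u = 0 &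
        forall a b c, R a -> R b -> R c ->
          L ((gr_of a - 1) * (gr_of b - 1) * (gr_of c - 1)) = f1 a * f2 b * f3 c].
Proof.
move=> nR f1M f3M iI Cf CI; have [CB _] := Cf.
have [L [d [d' [LB LE dE d'E]]]] := sandwich_functional freeF nR.1 f1M f3M CB.
exists L; split=> // [|a b c Ra Rb Rc]; first exact: (sandwich_kills nR iI LB LE).
have [da <-] := dE a Ra; have [d'c <-] := d'E c Rc.
by rewrite LE // (middle_formE Cf).
Qed.

(** For f' with f' (a g) = f a + f' g on S, the linear extension sends (h - 1) g to f h for every g
    in F. Hence it sends (h - 1) u to f h times the augmentation of u, which is 0 for u in
    Delta(F). *)
Lemma middle_form_sf R S f : normal_subgroup S -> R `<=` S -> hom_on S f ->
  exists2 C, middle_form R f C & forall u, (rel_ideal S ** aug_ideal setT) u -> C u = 0.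
Proof.
move=> [sS nS] RS fM; have [f' f'M] := hom_on_extend sS fM.
exists (lin f'); first split=> [|x b y /RS Sx /RS Sb _]; first exact: gr_linB.
  rewrite mulrBr mulrBl mulr1 -!gr_ofM gr_linB !lin_gr_of -mulgA !f'M //.
  by rewrite opprD addrACA subrr add0r addrK.
have sL := ker_additive (@gr_linB F _ f').
apply: (ideal_mul_subP sL) => u v Su fv; move: u Su.
apply: (rel_ideal_subP (preim_mulr_additive v sL)) => h w Sh.
rewrite /= -mulrA; move: (w * v) (idealMl w (@aug_ideal_ideal F) fv).
apply: (aug_ideal_subP (preim_mull_additive _ sL)) => x _.
rewrite /= mulrBr mulr1 mulrBl mul1r -gr_ofM !gr_linB !lin_gr_of.
by rewrite f'M // addrK -{2}[h]mulg1 f'M // addrK subrr.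
Qed.

(** The mirror image of [middle_form_sf]: inverting the argument and changing the sign gives a
    function equivariant under right multiplication by S. *)
Lemma middle_form_fs R S f : normal_subgroup S -> R `<=` S -> hom_on S f ->
  exists2 C, middle_form R f C & forall u, (aug_ideal setT ** rel_ideal S) u -> C u = 0.
Proof.
move=> nS RS fM; have [sS _] := nS; have [f0 f0M] := hom_on_extend sS fM.
pose f' x := - f0 (x^-1)%g.
have f'M g a : S a -> f' (g * a)%g = f' g + f a.
  move=> Sa; rewrite /f' invgM f0M ?(hom_onV sS fM) //; last exact: subgroupV.
  by rewrite opprD opprK addrC.
exists (lin f'); first split=> [|x b y /RS Sx /RS Sb /RS Sy]; first exact: gr_linB.
  rewrite mulrBr mulrBl mulr1 -!gr_ofM gr_linB !lin_gr_of !f'M //.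
  by rewrite opprD addrACA subrr addr0 addrAC subrr add0r.
have sL := ker_additive (@gr_linB F _ f').
apply: (ideal_mul_subP sL) => u v fu; move: v.
apply: (rel_ideal_subPr nS (preim_mull_additive u sL)) => h w Sh.
rewrite /= mulrA; move: (u * w) (idealMr w (@aug_ideal_ideal F) fu).
apply: (aug_ideal_subP (preim_mulr_additive _ sL)) => x _.
rewrite /= mulrBl mul1r mulrBr mulr1 -gr_ofM !gr_linB !lin_gr_of.
by rewrite f'M // [f' x + _]addrC addrK -[h]mul1g f'M // [_ + f h]addrC mul1g addrK subrr.
Qed.

End Functionals.

(** * Commutators of weight two and three *)

Section CommutatorCalculus.
Variable F : groupType.
Implicit Types (G R S : set F) (M : zmodType).

(* A homomorphism on [G, R] / [[G, R], R]. *)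
Definition central_hom G R M (f : F -> M) : Prop :=
  hom_on (commutator_subgroup G R) f /\
  forall x, commutator_subgroup (commutator_subgroup G R) R x -> f x = 0.

Lemma central_homJ G R M (f : F -> M) u x :
  normal_subgroup G -> normal_subgroup R -> central_hom G R f ->
  commutator_subgroup G R u -> R x -> f (u ^ x)%g = f u.
Proof.
move=> nG nR [fM f0] GRu Rx.
have ux := mem_commutator GRu Rx; have nGR := commutator_normal nG nR.
rewrite -[(u ^ x)%g](mulVKg u) -commgEl fM ?(f0 _ ux) ?addr0 //.
exact: (@commutator_normal_sub _ _ R nGR).
Qed.

(** Since f ignores conjugation by R, the identity [w w', z] = [w, z]^w' [w', z] becomes
    additivity. *)
Lemma central_hom_commMl G R M (f : F -> M) :
    normal_subgroup G -> normal_subgroup R -> G `<=` R -> central_hom G R f ->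
  forall z, R z -> hom_on G (fun w => f [~ w, z]%g).
Proof.
move=> nG nR GR cf z Rz w w' Gw Gw'.
have [_ nGR] := commutator_normal nG nR.
have GRwz w0 : G w0 -> commutator_subgroup G R [~ w0, z]%g by move=> ?; apply: mem_commutator.
have -> : [~ w * w', z]%g = ([~ w, z] ^ w' * [~ w', z])%g.
  by rewrite /commg /conjg !invgM !mulgA !mulgK.
rewrite cf.1 ?(central_homJ nG nR cf) //; try exact: GRwz; first exact: GR.
by apply: nGR; apply: GRwz.
Qed.

Lemma central_hom_commMr G R M (f : F -> M) :
    normal_subgroup G -> normal_subgroup R -> central_hom G R f ->
  forall w, G w -> hom_on R (fun z => f [~ w, z]%g).
Proof.
move=> nG nR cf w Gw z z' Rz Rz'.
have [_ nGR] := commutator_normal nG nR.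
have -> : [~ w, z * z']%g = ([~ w, z'] * [~ w, z] ^ z')%g.
  by rewrite /commg /conjg !invgM !mulgA !mulgK.
rewrite cf.1 ?(central_homJ nG nR cf) // 1?addrC //; first exact: mem_commutator.
  exact: mem_commutator.
by apply: nGR; apply: mem_commutator.
Qed.

Lemma Hall_Witt (x y z : F) :
  ([~ x, y^-1, z] ^ y * [~ y, z^-1, x] ^ z * [~ z, x^-1, y] ^ x = 1)%g.
Proof.
pose a x y z : F := (x * z * y ^ x)%g.
(* Each factor is a quotient of consecutive cyclic shifts of a, so the product telescopes. *)
suffices{x y z} hw_aux x y z: ([~ x, y^-1, z] ^ y = (a x y z)^-1 * (a y z x))%g.
  by rewrite !hw_aux; move: a {hw_aux} => a; rewrite 2!mulgA !mulgK mulVg.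
rewrite /a /commg /conjg !(invgM, invgK) !mulgA.
by rewrite ?mulgVK ?mulgK ?mulVg ?mul1g.
Qed.

(** Apply f to the Hall-Witt identity: f ignores the conjugations, and f [a, b^-1, c] = - f
    [a, b, c] by additivity in b. The remaining common sign is dropped. *)
Lemma triple_commutator_jacobi R M (f : F -> M) x y z :
    normal_subgroup R -> central_hom (commutator_subgroup R R) R f ->
    R x -> R y -> R z ->
  f [~ x, y, z]%g + f [~ y, z, x]%g + f [~ z, x, y]%g = 0.
Proof.
move=> nR cf Rx Ry Rz; have [sR _] := nR.
have nRR := commutator_normal nR nR.
have RRR := commutator_normal_sub (B := R) nR.
have cw w : R w -> central_hom R R (fun u => f [~ u, w]%g).
  move=> Rw; split; first exact: (central_hom_commMl nRR nR RRR cf Rw).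
  by move=> u Ru; apply: cf.2; apply: mem_commutator.
have fV a b c : R a -> R b -> R c -> f [~ a, b^-1, c]%g = - f [~ a, b, c]%g.
  move=> Ra Rb Rc.
  exact: (hom_onV sR (central_hom_commMr nR nR (cw c Rc) Ra) Rb).
have mem a b c : R a -> R b -> R c ->
    commutator_subgroup (commutator_subgroup R R) R [~ a, b, c]%g.
  by move=> Ra Rb Rc; do 2?apply: mem_commutator.
have sV a : R a -> R a^-1%g by apply: subgroupV.
have fJ a b c d : R a -> R b -> R c -> R d -> f ([~ a, b^-1, c] ^ d)%g = - f [~ a, b, c]%g.
  by move=> Ra Rb Rc Rd; rewrite (central_homJ nRR nR cf) ?fV //; apply: mem => //; apply: sV.
have [sRRR nRRR] := commutator_normal nRR nR.
have Jmem a b c d : R a -> R b -> R c ->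
    commutator_subgroup (commutator_subgroup R R) R ([~ a, b^-1, c] ^ d)%g.
  by move=> Ra Rb Rc; apply: nRRR; apply: mem => //; apply: sV.
have /(congr1 f) := Hall_Witt x y z.
have J1 := Jmem x y z y Rx Ry Rz; have J2 := Jmem y z x z Ry Rz Rx.
have J3 := Jmem z x y x Rz Rx Ry.
rewrite (hom_on1 sRRR cf.1) (cf.1 _ _ (subgroupM sRRR J1 J2) J3) (cf.1 _ _ J1 J2).
rewrite (fJ x y z y) // (fJ y z x z) // (fJ z x y x) //.
by rewrite -!opprD => /eqP; rewrite oppr_eq0 => /eqP.
Qed.

(* The class of x in R/R' is the sum of the c i times the class of e i. *)
Definition expands R (e : nat -> F) (n : nat) (x : F) (c : nat -> int) : Prop :=
  forall M (f : F -> M), hom_on R f -> f x = \sum_(i < n) f (e i) *~ c i.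

Definition generates R (e : nat -> F) (n : nat) (s : seq F) : Prop :=
  (forall k, R (e k)) /\ forall x, x \in s -> exists c, expands R e n x c.

Lemma generates_cat R e n s s' :
  generates R e n (s ++ s') -> generates R e n s /\ generates R e n s'.
Proof.
by move=> [Re es]; split; split=> // x xs; apply: es; rewrite mem_cat xs ?orbT.
Qed.

(** The finite list s is chosen first because an adapted basis is built for finitely many elements
    of R. The coefficients m come before M and f, so that the same m serves integer functionals and
    a quotient group. *)
Lemma commutator_expansion R g : normal_subgroup R -> commutator_subgroup R R g ->
  exists2 s : seq F, {in s, forall x, R x} &
    forall e n, generates R e n s -> exists m : nat -> nat -> int,
    forall M (f : F -> M), central_hom R R f ->
      f g = \sum_(i < n) \sum_(j < n) f [~ e i, e j]%g *~ m i j.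
Proof.
move=> nR; have sRR := commutator_is_subgroup R R.
pose P := [set g | commutator_subgroup R R g /\
  exists2 s : seq F, {in s, forall x, R x} &
    forall e n, generates R e n s -> exists m : nat -> nat -> int,
    forall M (f : F -> M), central_hom R R f ->
      f g = \sum_(i < n) \sum_(j < n) f [~ e i, e j]%g *~ m i j].
suff PRR : commutator_subgroup R R `<=` P by move=> /PRR[].
apply: commutator_subP => [|x y Rx Ry].
  split=> [|x y [Gx [s Rs es]] [Gy [s' Rs' es']]].
    split; first exact: sRR.1.
    exists [::] => // e n _; exists (fun _ _ => 0) => M f [fM _].
    by rewrite (hom_on1 sRR fM) big1 // => i _; rewrite big1.
  split; first exact: sRR.2.
  exists (s ++ s') => [z|e n /generates_cat[/es[m mE] /es'[m' m'E]]].
    by rewrite mem_cat => /orP[/Rs|/Rs'].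
  exists (fun i j => m i j - m' i j) => M f cf; have [fM _] := cf.
  rewrite fM ?(hom_onV sRR fM) //; last exact: (subgroupV sRR).
  rewrite (mE _ _ cf) (m'E _ _ cf) -sumrB; apply: eq_bigr => i _.
  by rewrite -sumrB; apply: eq_bigr => j _; rewrite mulrzBr.
split; first exact: mem_commutator.
exists [:: x; y] => [z|e n [Re es]]; first by rewrite !inE => /orP[]/eqP->.
have [c cE] : exists c, expands R e n x c by apply: es; rewrite inE eqxx.
have [c' c'E] : exists c, expands R e n y c by apply: es; rewrite !inE eqxx orbT.
exists (fun i j => c' j * c i) => M f cf.
rewrite (cE _ _ (central_hom_commMl nR nR _ cf Ry)) //; apply: eq_bigr => i _.
rewrite (c'E _ _ (central_hom_commMr nR nR cf (Re i))) mulrz_suml.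
by apply: eq_bigr => j _; rewrite mulrzA.
Qed.

Lemma triple_commutator_expansion R g : normal_subgroup R ->
    commutator_subgroup (commutator_subgroup R R) R g ->
  exists2 s : seq F, {in s, forall x, R x} &
    forall e n, generates R e n s -> exists m : nat -> nat -> nat -> int,
    forall M (f : F -> M), central_hom (commutator_subgroup R R) R f ->
      f g = \sum_(i < n) \sum_(j < n) \sum_(k < n) f [~ e i, e j, e k]%g *~ m i j k.
Proof.
move=> nR; have nRR := commutator_normal nR nR.
have RRR := commutator_normal_sub (B := R) nR.
have sG := commutator_is_subgroup (commutator_subgroup R R) R.
pose P := [set g | commutator_subgroup (commutator_subgroup R R) R g /\
  exists2 s : seq F, {in s, forall x, R x} &
    forall e n, generates R e n s -> exists m : nat -> nat -> nat -> int,
    forall M (f : F -> M), central_hom (commutator_subgroup R R) R f ->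
      f g = \sum_(i < n) \sum_(j < n) \sum_(k < n) f [~ e i, e j, e k]%g *~ m i j k].
suff PG : commutator_subgroup (commutator_subgroup R R) R `<=` P by move=> /PG[].
apply: commutator_subP => [|w z RRw Rz].
  split=> [|x y [Gx [s Rs es]] [Gy [s' Rs' es']]].
    split; first exact: sG.1.
    exists [::] => // e n _; exists (fun _ _ _ => 0) => M f [fM _].
    by rewrite (hom_on1 sG fM) big1 // => i _; rewrite big1 // => j _; rewrite big1.
  split; first exact: sG.2.
  exists (s ++ s') => [z|e n /generates_cat[/es[m mE] /es'[m' m'E]]].
    by rewrite mem_cat => /orP[/Rs|/Rs'].
  exists (fun i j k => m i j k - m' i j k) => M f cf; have [fM _] := cf.
  rewrite fM ?(hom_onV sG fM) //; last exact: (subgroupV sG).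
  rewrite (mE _ _ cf) (m'E _ _ cf) -sumrB; apply: eq_bigr => i _.
  rewrite -sumrB; apply: eq_bigr => j _; rewrite -sumrB; apply: eq_bigr => k _.
  by rewrite mulrzBr.
split; first exact: mem_commutator.
have [s Rs es] := commutator_expansion nR RRw.
exists (z :: s) => [x|e n ez].
  by rewrite inE => /orP[/eqP->|/Rs].
have [[Re zc] gs] := @generates_cat R e n [:: z] s ez.
have [c cE] := zc z (mem_head _ _); have [m mE] := es e n gs.
exists (fun i j k => c k * m i j) => M f cf.
(* The map u |-> f [u, z] is itself a central homomorphism on [R, R], so the expansion of w in
   weight two applies to it. *)
rewrite (mE M (fun u => f [~ u, z]%g)); last first.
  split; first exact: (central_hom_commMl nRR nR RRR cf Rz).
  by move=> u Ru; apply: cf.2; apply: mem_commutator.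
apply: eq_bigr => i _; apply: eq_bigr => j _.
have RRij : commutator_subgroup R R [~ e i, e j]%g by apply: mem_commutator.
rewrite (cE _ _ (central_hom_commMr nRR nR cf RRij)) mulrz_suml.
by apply: eq_bigr => k _; rewrite mulrzA.
Qed.

End CommutatorCalculus.

(** * Bases adapted to a chain of subgroups *)

Section Echelon.
Variable V : zmodType.
Implicit Types (B : V -> Prop) (P : (V -> int) -> Prop) (s : seq V).

Lemma zmod_morphism_lin (f : V -> int) u v (m n : int) : zmod_morphism f ->
  f (u *~ m + v *~ n) = f u * m + f v * n.
Proof.
move=> fB; pose f' := HB.pack_for {additive V -> int} f (GRing.isZmodMorphism.Build V int f fB).
apply: etrans (raddfD f' _ _) _; rewrite /=.
have fMz w c : f (w *~ c) = f w * c.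
  by apply: etrans (raddfMz f' _ _) _; rewrite -[RHS](congr1 _ (intz c)) mulrzr.
by rewrite !fMz.
Qed.

(** Equality of the generated subgroups, tested on closed predicates instead of explicit
    combinations. *)
Definition same_span s s' : Prop :=
  forall B, zclosed B -> {in s, forall v, B v} <-> {in s', forall v, B v}.

(** With f u = p d, f v = q d and a p + b q = 1, the substitution (u, v) -> (a u + b v, - q u + p v)
    has determinant 1, and f kills the second vector. *)
Lemma euclid_pair (f : V -> int) u v : zmod_morphism f ->
  exists u' v', f v' = 0 /\ same_span [:: u; v] [:: u'; v'].
Proof.
move=> fB; have f0 := (ker_zclosed fB).1.
have [a [b ab]] := Bezoutz (f u) (f v).
set d := gcdz (f u) (f v) in ab.
have [d0|dN0] := eqVneq d 0.
  by exists u, v; split=> //; apply/eqP; move/eqP: d0; rewrite gcdz_eq0 => /andP[].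
pose p := (f u %/ d)%Z; pose q := (f v %/ d)%Z.
have fu : f u = p * d by rewrite divzK // dvdz_gcdl.
have fv : f v = q * d by rewrite divzK // dvdz_gcdr.
have apbq : a * p + b * q = 1.
  by apply: (mulIf dN0); rewrite mul1r mulrDl -!mulrA -fu -fv.
exists (u *~ a + v *~ b), (u *~ - q + v *~ p); split.
  by rewrite zmod_morphism_lin // fu fv; ring.
move=> B sB; split=> Bs w; rewrite !inE.
  have [Bu Bv] : B u /\ B v by split; apply: Bs; rewrite !inE eqxx ?orbT.
  by case/orP=> /eqP->; apply: zclosedD => //; apply: zclosedMz.
set u' := _ + _ in Bs; set v' := _ + _ in Bs.
have [Bu Bv] : B u' /\ B v' by split; apply: Bs; rewrite !inE eqxx ?orbT.
case/orP=> /eqP->.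
  have -> : u = u' *~ p + v' *~ - b.
    rewrite /u' /v' !mulrzDl -!mulrzA addrACA -!mulrzDr.
    have -> : a * p + - q * - b = 1 by rewrite -apbq; ring.
    by rewrite mulr1z (_ : b * p + p * - b = 0) ?mulr0z ?addr0 //; ring.
  by apply: zclosedD => //; apply: zclosedMz.
have -> : v = u' *~ q + v' *~ a.
  rewrite /u' /v' !mulrzDl -!mulrzA addrACA -!mulrzDr.
  have -> : b * q + p * a = 1 by rewrite -apbq; ring.
  by rewrite mulr1z (_ : a * q + - q * a = 0) ?mulr0z ?add0r //; ring.
by apply: zclosedD => //; apply: zclosedMz.
Qed.

Lemma euclid_seq (f : V -> int) v0 s : zmod_morphism f -> 
  exists v s', [/\ size s' = size s, {in s', forall w, f w = 0} & same_span (v0 :: s) (v :: s')].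
Proof.
move=> fB; elim: s v0 => [|w s IHs] v0; first by exists v0, [::].
have [v [s' [ss' fs' sp]]] := IHs w.
have [u' [v' [fv' sp']]] := euclid_pair v0 v fB.
exists u', (v' :: s'); split=> [|x|B sB]; first by rewrite /= ss'.
  by rewrite inE => /orP[/eqP->|/fs'].
have cons x t : {in x :: t, forall v, B v} <-> B x /\ {in t, forall v, B v}.
  split=> [Bxt|[Bx Bt] y]; last by rewrite inE => /orP[/eqP->|/Bt].
  by split=> [|y yt]; apply: Bxt; rewrite inE ?eqxx // yt orbT.
have := sp B sB; have := sp' B sB; rewrite !cons => H1 H2.
have nB : {in [::], forall v, B v} by [].
tauto.
Qed.

(* Forms in P1 are used before the other forms in P2, so that the vectors killed by all of P1
   come last. *)
Record echelon P1 P2 s (n : nat) (e : nat -> V) (f : nat -> V -> int) : Prop := Echelon {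
  echelon_mem : forall i, (i < n)%N -> P2 (f i) /\ f i (e i) != 0;
  echelon_diag : forall i j, (i < n)%N -> (j < n)%N -> i <> j -> f i (e j) = 0;
  echelon_tier : forall i, (i < n)%N -> P1 (f i) \/ forall g, P1 g -> g (e i) = 0;
  echelon_up : forall i j, (i < j < n)%N ->
    (forall g, P1 g -> g (e i) = 0) -> forall g, P1 g -> g (e j) = 0;
  echelon_span : forall B, zclosed B -> (forall i, (i < n)%N -> B (e i)) -> {in s, forall v, B v};
  echelon_sub : forall B, zclosed B -> {in s, forall v, B v} -> forall i, (i < n)%N -> B (e i)
}.

Definition form_closed P : Prop :=
  (forall f, P f -> zmod_morphism f) /\
  forall f g (m n : int), P f -> P g -> P (fun v => f v * m + g v * n).

(** Gaussian elimination over Z by induction on the size of s: pick a form f nonzero on s, reduce s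
    to a vector u with f u != 0 and a list t killed by f, and recurse on t. *)
Lemma echelon_exists P1 P2 s : form_closed P1 -> form_closed P2 ->
    (forall f, P1 f -> P2 f) -> (forall v, (forall f, P2 f -> f v = 0) -> v = 0) ->
  exists n e f, echelon P1 P2 s n e f.
Proof.
move=> [P1B P1D] [P2B P2D] P12 P2sep.
have [k] := ubnP (size s); elim: k s => // k IHk s; rewrite ltnS => sk.
have [s0|[v0 [v0s v0N0]]] : {in s, forall v, v = 0} \/ exists v, v \in s /\ v <> 0.
- have [[v [vs v0]]|H] := pselect (exists v, v \in s /\ v <> 0); first by right; exists v.
  by left=> v vs; apply: contrapT => v0; apply: H; exists v.
- exists 0%N, (fun=> 0), (fun _ _ => 0); split=> //.
  by move=> B [B0 _] _ v /s0 ->.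
(* A form of P1 is taken whenever one is nonzero on s; otherwise P1 kills s, and with it every
   remaining basis vector. *)
have [f [P2f fs P1s]] : exists f, [/\ P2 f, exists2 v, v \in s & f v != 0 &
    P1 f \/ forall g, P1 g -> {in s, forall v, g v = 0}].
- have [[f [P1f fs]]|H] := pselect (exists f, P1 f /\ exists2 v, v \in s & f v != 0).
    by exists f; split=> //; [apply: P12|left].
  have [f [P2f fv0]] : exists f, P2 f /\ f v0 <> 0.
    apply: contrapT => H'; apply: v0N0; apply: P2sep => f P2f.
    by apply: contrapT => fv0; apply: H'; exists f.
  exists f; split=> //; first by exists v0 => //; apply/eqP.
  right=> g P1g v vs; apply/eqP/negPn/negP => gv.
  by apply: H; exists g; split=> //; exists v.
have fB := P2B f P2f.
have [u [t [st ft sp]]] : exists u t,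
    [/\ (size t < k)%N, {in t, forall w, f w = 0} & same_span s (u :: t)].
  case: s sk fs {v0s P1s} => [|w s] sk [v vs _]; first by rewrite in_nil in vs.
  have [u [t [st ft sp]]] := euclid_seq w s fB.
  by exists u, t; rewrite st.
have sput B : zclosed B -> {in s, forall v, B v} -> B u /\ {in t, forall v, B v}.
  move=> sB /(sp B sB) But; split; first by apply: But; rewrite mem_head.
  by move=> w wt; apply: But; rewrite inE wt orbT.
have fu : f u != 0.
  case: fs => v vs; apply: contraNneq => fu.
  apply/eqP; apply: (sp _ (ker_zclosed fB)).2 vs => w.
  by rewrite inE => /orP[/eqP->|/ft].
have [n [e [g E]]] := IHk t st.
have fe j : (j < n)%N -> f (e j) = 0 by move=> jn; apply: (echelon_sub E (ker_zclosed fB) ft).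
have P1e g0 : (forall g, P1 g -> {in s, forall v, g v = 0}) -> P1 g0 ->
    g0 u = 0 /\ forall j, (j < n)%N -> g0 (e j) = 0.
  move=> P1s0 P1g0; have kg0 := ker_zclosed (P1B g0 P1g0).
  have [gu gt] := sput _ kg0 (P1s0 g0 P1g0); split=> // j jn.
  exact: (echelon_sub E kg0 gt).
(* The later forms are corrected by f so as to vanish at u; as f kills the later vectors, this only
   scales the values there by f u. *)
exists n.+1, (fun i => if i is j.+1 then e j else u),
  (fun i => if i is j.+1 then fun v => g j v * f u + f v * - g j u else f).
split=> [[|j] jn|[|j] [|l] jn ln jl //|[|j] jn|[|j] [|l] //= jl Hg g0 P1g0|
  B sB Be|B sB /(sput B sB)[Bu Bt] [|j] //].
- by [].
- have [P2g gN0] := echelon_mem E jn; split; first exact: P2D.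
  by rewrite fe // mul0r addr0 mulf_neq0.
- exact: fe.
- ring.
- by rewrite (echelon_diag E) ?fe ?mul0r ?addr0 //; move=> jl'; apply: jl; rewrite jl'.
- case: P1s => [|P1s]; [by left|right=> g0 P1g0].
  by have [] := P1e g0 P1s P1g0.
- case: P1s => [P1f|P1s]; last by right=> g0 P1g0; have [_ ->] := P1e g0 P1s P1g0.
  case: (echelon_tier E jn) => [P1g|]; [left; exact: P1D|by right].
- case: P1s => [P1f|P1s]; last by have [_ ->] := P1e g0 P1s P1g0.
  by have := Hg f P1f => /eqP; rewrite (negPf fu).
- exact: (echelon_up E jl Hg).
- apply: (sp B sB).2 => w; rewrite inE => /orP[/eqP->|]; first exact: (Be 0%N).
  by apply: (echelon_span E sB) => j jn; apply: (Be j.+1).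
by move=> jn; apply: (echelon_sub E sB Bt).
Qed.

End Echelon.

(** * Lie elements of degree two and three *)

(** The alternating t is the difference of its strictly upper triangular part b and the transpose of
    b, so the symmetry of m suffices and no division by 2 occurs in M. *)
Lemma bilinear_sum_eq0 (M : zmodType) (n : nat) (t : nat -> nat -> M) (m : nat -> nat -> int) :
    (forall i, t i i = 0) -> (forall i j, t i j = - t j i) ->
    (forall i j, (i < n)%N -> (j < n)%N -> m i j = m j i) ->
  \sum_(i < n) \sum_(j < n) t i j *~ m i j = 0.
Proof.
move=> tii tij mij; pose b i j := if (i < j)%N then t i j else 0.
have tb i j : t i j = b i j - b j i.
  rewrite /b; case: (ltngtP i j) => [_|_|->]; by rewrite ?subr0 ?sub0r ?tii.
transitivity (\sum_(i < n) \sum_(j < n) b i j *~ m i j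
    - \sum_(i < n) \sum_(j < n) b j i *~ m i j).
  rewrite -sumrB; apply: eq_bigr => i _; rewrite -sumrB; apply: eq_bigr => j _.
  by rewrite tb mulrzBl.
rewrite [X in _ - X]exchange_big /=; apply/eqP; rewrite subr_eq0; apply/eqP.
by apply: eq_bigr => i _; apply: eq_bigr => j _; rewrite mij.
Qed.

Section TripleSums.
Variables (M : zmodType) (n : nat).
Implicit Types G H : nat -> nat -> nat -> M.

Definition sum3 G : M := \sum_(i < n) \sum_(j < n) \sum_(k < n) G i j k.

Lemma sum3_eq G H : (forall i j k, (i < n)%N -> (j < n)%N -> (k < n)%N -> G i j k = H i j k) ->
  sum3 G = sum3 H.
Proof. by move=> GH; do 3![apply: eq_bigr => ? _]; apply: GH. Qed.

Lemma sum3B G H : sum3 G - sum3 H = sum3 (fun i j k => G i j k - H i j k).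
Proof. by rewrite /sum3; do 2![rewrite -sumrB; apply: eq_bigr => ? _]; rewrite sumrB. Qed.

Lemma sum3D G H : sum3 G + sum3 H = sum3 (fun i j k => G i j k + H i j k).
Proof.
by rewrite /sum3; do 2![rewrite -big_split; apply: eq_bigr => ? _]; rewrite big_split.
Qed.

Lemma sum3_swap12 G : sum3 G = sum3 (fun i j k => G j i k).
Proof. exact: exchange_big. Qed.

Lemma sum3_swap23 G : sum3 G = sum3 (fun i j k => G i k j).
Proof. by apply: eq_bigr => i _; apply: exchange_big. Qed.

Lemma sum3_rot G : sum3 G = sum3 (fun i j k => G j k i).
Proof. by rewrite sum3_swap23 sum3_swap12. Qed.

(** The index permutations undo those in [[x, y], z] = xyz - yxz - zxy + zyx, so that terms with
    equal monomials are collected. *)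
Lemma sum3_Lie G1 G2 G3 G4 :
  sum3 G1 - sum3 G2 - sum3 G3 + sum3 G4 =
  sum3 (fun i j k => G1 i j k - G2 j i k - G3 j k i + G4 k j i).
Proof.
rewrite [sum3 G2]sum3_swap12 [sum3 G3]sum3_rot [sum3 G4]sum3_rot [X in _ + X]sum3_swap23.
by rewrite !sum3B sum3D.
Qed.

End TripleSums.

Lemma sum_diag (n a : nat) (d G : nat -> int) : (a < n)%N ->
  (forall l, (l < n)%N -> a <> l -> d l = 0) -> \sum_(l < n) d l * G l = d a * G a.
Proof.
move=> an d0; rewrite (bigD1 (Ordinal an)) //= big1 ?addr0 // => l /eqP la.
by rewrite d0 ?mul0r // => al; apply: la; apply: val_inj.
Qed.

(** x and y act as dual basis forms up to scale: evaluating them on the expansion of sum m_ij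
    [e_i, e_j] isolates the coefficient of e_a e_b. [lie_sum3_diag] is the analogue in degree
    three. *)
Lemma lie_sum2_diag (n a b : nat) (x y : nat -> int) (m : nat -> nat -> int) :
    (a < n)%N -> (b < n)%N ->
    (forall l, (l < n)%N -> a <> l -> x l = 0) -> (forall l, (l < n)%N -> b <> l -> y l = 0) ->
  \sum_(i < n) \sum_(j < n) (x i * y j - x j * y i) *~ m i j = x a * y b * (m a b - m b a).
Proof.
move=> an bn x0 y0.
transitivity (\sum_(i < n) \sum_(j < n) x i * y j * m i j
    - \sum_(i < n) \sum_(j < n) x j * y i * m i j).
  rewrite -sumrB; apply: eq_bigr => i _; rewrite -sumrB; apply: eq_bigr => j _.
  by rewrite -mulrzr intz mulrBl.
rewrite [X in _ - X]exchange_big /= -sumrB.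
under eq_bigr => i _ do rewrite -sumrB.
transitivity (\sum_(i < n) x i * (\sum_(j < n) y j * (m i j - m j i))).
  apply: eq_bigr => i _; rewrite mulr_sumr; apply: eq_bigr => j _.
  by rewrite -mulrBr mulrA.
by rewrite (sum_diag (fun i => \sum_(j < n) y j * (m i j - m j i)) an x0)
  (sum_diag (fun j => m a j - m j a) bn y0) mulrA.
Qed.

Lemma lie_sum3_diag (n a b c : nat) (x y z : nat -> int) (m : nat -> nat -> nat -> int) :
    (a < n)%N -> (b < n)%N -> (c < n)%N ->
    (forall l, (l < n)%N -> a <> l -> x l = 0) -> (forall l, (l < n)%N -> b <> l -> y l = 0) ->
    (forall l, (l < n)%N -> c <> l -> z l = 0) ->
  sum3 n (fun i j k => (x i * y j * z k - x j * y i * z k - x k * y i * z j + x k * y j * z i)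
    *~ m i j k) = x a * y b * z c * (m a b c - m b a c - m b c a + m c b a).
Proof.
move=> an bn cn x0 y0 z0.
transitivity (sum3 n (fun i j k => x i * y j * z k * m i j k)
    - sum3 n (fun i j k => x j * y i * z k * m i j k)
    - sum3 n (fun i j k => x k * y i * z j * m i j k)
    + sum3 n (fun i j k => x k * y j * z i * m i j k)).
  rewrite !sum3B sum3D; apply: sum3_eq => i j k _ _ _.
  by rewrite -mulrzr intz mulrDl !mulrBl.
rewrite sum3_Lie.
transitivity (\sum_(i < n) x i * (\sum_(j < n) y j * (\sum_(k < n) z k *
    (m i j k - m j i k - m j k i + m k j i)))).
  apply: eq_bigr => i _; rewrite mulr_sumr; apply: eq_bigr => j _.
  by rewrite !mulr_sumr; apply: eq_bigr => k _; ring.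
rewrite (sum_diag (fun i => \sum_(j < n) y j * (\sum_(k < n) z k *
    (m i j k - m j i k - m j k i + m k j i))) an x0).
rewrite (sum_diag (fun j => \sum_(k < n) z k * (m a j k - m j a k - m j k a + m k j a)) bn y0).
by rewrite (sum_diag (fun k => m a b k - m b a k - m b k a + m k b a) cn z0) !mulrA.
Qed.

(* [t i j k] stands for [e_i, e_j, e_k] and [T a b c] is the coefficient of
   e_a e_b e_c in the expansion of the Lie element sum m_ijk [e_i, e_j, e_k]. *)
Lemma lie_sum_eq0 (M : zmodType) (n : nat) (U : nat -> Prop)
    (t : nat -> nat -> nat -> M) (m : nat -> nat -> nat -> int) :
  let T a b c := m a b c - m b a c - m b c a + m c b a in
    (forall i k, t i i k = 0) -> (forall i j k, t i j k = - t j i k) ->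
    (forall i j k, t i j k + t j k i + t k i j = 0) ->
    (forall i j, (i < j < n)%N -> U i -> U j) ->
    (forall i j k, (i < n)%N -> (j < n)%N -> U i -> U j -> t i j k = 0) ->
    (forall a b c, (a < n)%N -> (b < n)%N -> (c < n)%N -> ~ U b -> T a b c = 0) ->
  sum3 n (fun i j k => t i j k *~ m i j k) = 0.
Proof.
move=> T tii tij tJ Uup tU TU.
(* A linear retraction of the inclusion of Lie elements into tensors. *)
pose b i j k := if (j < i)%N && (k < i)%N then - t j i k
                else if (j == k) && (i < j)%N then t i j j else 0.
have tb i j k : t i j k = b i j k - b j i k - b k i j + b k j i.
  have tJ' : t i j k = t i k j + t k j i.
    have /eqP := tJ i j k; rewrite -addrA addr_eq0 opprD => /eqP ->.
    by rewrite addrC -!tij.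
  rewrite /b; case: (ltngtP i j) => [ij|ji|ij]; case: (ltngtP i k) => [ik|ki|ik];
    case: (ltngtP j k) => [jk|kj|jk]; try (by exfalso; lia);
    try subst k; try subst j; rewrite /= ?eqxx ?ltnn /=;
    rewrite ?(subr0, sub0r, addr0, add0r, opprK, subrr, tii, oppr0, addNr) //;
    try (by rewrite tJ' (tij k j)).
(* Substituting [tb] and reindexing moves the four permutations from b to m, where they form T. *)
transitivity (sum3 n (fun i j k => b i j k *~ T i j k)).
  transitivity (sum3 n (fun i j k => b i j k *~ m i j k) - sum3 n (fun i j k => b j i k *~ m i j k)
      - sum3 n (fun i j k => b k i j *~ m i j k) + sum3 n (fun i j k => b k j i *~ m i j k)).
    by rewrite !sum3B sum3D; apply: sum3_eq => i j k _ _ _; rewrite {1}tb !mulrzDl !mulNrz.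
  by rewrite sum3_Lie; apply: sum3_eq => i j k _ _ _; rewrite !mulrzDr !mulrNz.
rewrite (@sum3_eq _ _ _ (fun _ _ _ => 0)) => [|i j k ni nj nk].
  by rewrite /sum3; do 3![rewrite big1 // => ? _].
have [Uj|/TU Tj] := EM (U j); last by rewrite Tj.
rewrite /b; case: ifPn => [/andP[ji ki]|_].
  by rewrite tU ?oppr0 ?mul0rz //; apply: Uup Uj; rewrite ji.
case: ifP => [/andP[/eqP jk ij]|_]; last by rewrite mul0rz.
have [Ui|Ui] := EM (U i); first by rewrite tU ?mul0rz.
(* T j i j = 2 (m j i j - m i j j) vanishes, its middle index lying outside U; hence so does T i j j
   = m i j j - m j i j. *)
have := TU j i j nj ni nj Ui; rewrite /T -jk => Tj.
have -> : m i j j - m j i j - m j j i + m j j i = 0 by lia.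
by rewrite mulr0z.
Qed.
(** * Dimension subgroups *)

Lemma hom_on_commutator (F : groupType) (H : set F) (M : zmodType) (f : F -> M) x :
  subgroup H -> hom_on H f -> commutator_subgroup H H x -> f x = 0.
Proof.
move=> sH fM; pose P := [set x | H x /\ f x = 0].
suff HP : commutator_subgroup H H `<=` P by move=> /HP[].
apply: commutator_subP => [|y z Hy Hz].
  split=> [|y z [Hy fy] [Hz fz]]; first by split; [exact: sH.1 | exact: hom_on1 fM].
  split; first exact: sH.2.
  by rewrite fM ?(hom_onV sH fM) ?fy ?fz ?subrr //; apply: subgroupV.
split; first exact: subgroupR.
have Hy' := subgroupV sH Hy; have Hz' := subgroupV sH Hz.
rewrite /commg /conjg !fM ?(hom_onV sH fM) //; do ?[apply: subgroupM => //].
by rewrite [f y + _]addrC addKr addNr.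
Qed.

Section AdaptedBasis.
Variables (F : groupType) (X : Type) (i : X -> F).
Hypothesis freeF : free_on i.
Implicit Types (R S : set F).

(* R/R' and its image in S/S' are torsion-free, so that the Z-span in R/R' of finitely many
   elements has a basis whose last members span the kernel of R/R' -> S/S'. *)
Record adapted_basis R S (n : nat) (e : nat -> F) (f : nat -> F -> int) : Prop := AdaptedBasis {
  adapted_mem : forall k, R (e k);
  adapted_hom : forall k, (k < n)%N -> hom_on R (f k) /\ f k (e k) != 0;
  adapted_diag : forall k l, (k < n)%N -> (l < n)%N -> k <> l -> f k (e l) = 0;
  adapted_ext : forall k, (k < n)%N -> commutator_subgroup S S (e k) \/
    exists2 g : F -> int, hom_on S g & forall x, R x -> f k x = g x;
  adapted_up : forall k l, (k < l < n)%N ->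
    commutator_subgroup S S (e k) -> commutator_subgroup S S (e l)
}.

(** Apply [echelon_exists] to R/R', with all integral forms as P2 and those induced by homomorphisms
    S -> Z as P1; [hom_separation] for R shows that P2 separates points. *)
Lemma adapted_basis_exists R S (s : seq F) :
    normal_subgroup R -> normal_subgroup S -> R `<=` S -> {in s, forall x, R x} ->
  exists n e f, adapted_basis R S n e f /\ generates R e n s.
Proof.
move=> [sR nR] [sS nS] RS sRs; have sR' := commutator_is_subgroup R R.
have [|x y Rx Ry|V [q [rep [qM q0 q1 Rrep repK]]]] := abelian_quotient sR sR'.
- by apply: commutator_subP => // x y; apply: subgroupR.
- exact: mem_commutator.
have fac (M : zmodType) (f : F -> M) x : hom_on R f -> R x -> f (rep (q x)) = f x.
  move=> fM Rx; apply/eqP; rewrite -subr_eq0 -(hom_onV sR fM) // -fM //; last exact: subgroupV.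
  have Rx' : R (rep (q x) / x)%g by apply: sR.2.
  rewrite (hom_on_commutator sR fM) //; apply: q0 => //.
  by rewrite qM ?(hom_onV sR qM) ?repK ?subrr //; apply: subgroupV.
have facB (M : zmodType) (f : F -> M) : hom_on R f -> zmod_morphism (f \o rep).
  move=> fM u v /=; have Rv := subgroupV sR (Rrep v).
  have -> : u - v = q (rep u / rep v)%g by rewrite qM ?(hom_onV sR qM) ?repK.
  by rewrite fac // ?fM ?(hom_onV sR fM) //; apply: sR.2.
have hom_q (g : V -> int) : zmod_morphism g -> hom_on R (g \o q).
  move=> gB x y Rx Ry /=.
  by rewrite qM // (zmod_morphismD gB).
pose P1 (g : V -> int) := zmod_morphism g /\
  exists2 h : F -> int, hom_on S h & forall x, R x -> g (q x) = h x.
have P1rep g v : P1 g -> commutator_subgroup S S (rep v) -> g v = 0.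
  move=> [gB [h hM gh]] Sv; rewrite -(repK v) gh //.
  exact: (hom_on_commutator sS hM Sv).
(* [hom_separation] for S: an element of R killed by all homomorphisms S -> Z lies in S'. Together
   with [P1rep], the common kernel of P1 is the image of the intersection of R and S'. *)
have repP1 v : (forall g, P1 g -> g v = 0) -> commutator_subgroup S S (rep v).
  move=> gv; apply: (hom_separation freeF sS (RS _ (Rrep v))) => h hM.
  have hR : hom_on R h by move=> x y /RS Sx /RS Sy; apply: hM.
  by apply: (gv (h \o rep)); split; [exact: facB | exists h => // x Rx; apply: fac].
have P1cl : form_closed P1.
  split=> [g []//|g g' m m' [gB [h hM gh]] [g'B [h' h'M g'h']]]; split=> [u v|].
    by rewrite gB g'B; ring.
  exists (fun x => h x * m + h' x * m') => [x y Sx Sy|x Rx]; last by rewrite gh ?g'h'.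
  by rewrite hM ?h'M //; ring.
have P2cl : form_closed (fun g : V -> int => zmod_morphism g).
  by split=> // g g' m m' gB g'B u v; rewrite gB g'B; ring.
have P2sep v : (forall g : V -> int, zmod_morphism g -> g v = 0) -> v = 0.
  move=> gv; rewrite -(repK v); apply: q1.
  apply: (hom_separation freeF sR (Rrep v)) => h hM.
  exact: (gv (h \o rep) (facB _ h hM)).
have [g []//|n [e [f E]]] := echelon_exists (map q s) P1cl P2cl _ P2sep.
exists n, (rep \o e), (fun k => f k \o q); split; first split=> /=.
- by [].
- by move=> k kn; have [fB fN0] := echelon_mem E kn; split; [exact: hom_q | rewrite /= repK].
- by move=> k l kn ln kl; rewrite repK (echelon_diag E).
- move=> k kn; case: (echelon_tier E kn) => [[_ [h hM fh]]|U]; last by left; apply: repP1.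
  by right; exists h.
- move=> k l kl Sk; apply: repP1; apply: (echelon_up E kl) => g P1g.
  exact: P1rep.
split=> [k|x xs] /=; first exact: Rrep.
pose B (v : V) := exists c : nat -> int, v = \sum_(k < n) e k *~ c k.
have [||c qx] := echelon_span E (B := B) _ _ (map_f q xs).
- split=> [|u v [c ->] [c' ->]].
    by exists (fun=> 0); rewrite big1.
  exists (fun k => c k - c' k); rewrite -sumrB; apply: eq_bigr => k _.
  by rewrite mulrzBr.
- move=> k kn; exists (fun l => (l == k)%:Z).
  rewrite (bigD1 (Ordinal kn)) //= eqxx mulr1z big1 ?addr0 // => l.
  by rewrite -val_eqE /= => /negPf ->.
exists c => M f' f'M; rewrite -fac //; last exact: sRs.
pose g := HB.pack_for {additive V -> M} (f' \o rep)
  (GRing.isZmodMorphism.Build V M (f' \o rep) (facB M f' f'M)).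
rewrite qx -[LHS]/(g _) (raddf_sum g); apply: eq_bigr => k _.
by rewrite raddfMz.
Qed.

End AdaptedBasis.

(** * Values of functionals on the lower central series *)

Section LowerCentralFunctionals.
Variable F : groupType.
Implicit Types (R : set F) (L : group_ring F -> int).

(* c is the leading term of [w, z] - 1. *)
Lemma commutator_rel_pow R n w z : normal_subgroup R -> R w -> R z ->
    dimension_subgroup (rel_pow R n) w ->
  let c := (gr_of w - 1) * (gr_of z - 1) - (gr_of z - 1) * (gr_of w - 1) in
  rel_pow R n.+1 c /\ rel_pow R n.+2 (gr_of [~ w, z]%g - 1 - c).
Proof.
move=> nR Rw Rz Iw c; have [sR _] := nR.
have mem x : R x -> rel_ideal R (gr_of x - 1) by apply: mem_rel_ideal; apply: sR.1.
have Ic : rel_pow R n.+1 c.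
  apply: (rel_pow_ideal n.+1 nR).1.2; first by apply: mem_ideal_mul => //; apply: mem.
  by rewrite -rel_powSr; apply: mem_ideal_mul => //; apply: mem.
split=> //; rewrite gr_of_commg -/c -[X in _ - X]mul1r -mulrBl -rel_powSr.
by apply: mem_ideal_mul => //; apply: mem; apply: subgroupM => //; apply: subgroupV.
Qed.

Lemma lower_central_sub R n : normal_subgroup R -> lower_central R n.+1 `<=` R.
Proof.
move=> nR; elim: n => [//|n IHn]; apply: subset_trans IHn.
exact: (commutator_normal_sub (lower_central_normal n.+1 nR)).
Qed.

(** In xy - 1 = (x - 1)(y - 1) + (x - 1) + (y - 1) the product lies in r^(n+3), which is
    [rel_pow R n.+2], when x and y lie in gamma_(n+2)(R). *)
Lemma functional_central_hom R L n : normal_subgroup R -> zmod_morphism L ->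
    (forall u, rel_pow R n.+2 u -> L u = 0) ->
  central_hom (lower_central R n.+1) R (fun x => L (gr_of x - 1)).
Proof.
move=> nR LB L0; split=> [x y Gx Gy|x Gx]; last first.
  by apply: L0; apply: (@lower_central_dimension F R n.+2 nR).
have -> : gr_of (x * y)%g - 1 = (gr_of x - 1) * (gr_of y - 1) + (gr_of x - 1) + (gr_of y - 1).
  rewrite gr_ofM mulrBr mulr1 subrK mulrBl mul1r.
  by rewrite addrA subrK.
rewrite !(zmod_morphismD LB) L0 ?add0r //.
apply: mem_ideal_mul; first exact: (@lower_central_dimension F R n.+1 nR).
by apply: mem_rel_ideal; [exact: nR.1.1 | apply: (@lower_central_sub R n.+1)].
Qed.

Lemma functional_commutator R L x y : normal_subgroup R -> zmod_morphism L ->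
    (forall u, rel_pow R 2 u -> L u = 0) -> R x -> R y ->
  L (gr_of [~ x, y]%g - 1) =
  L ((gr_of x - 1) * (gr_of y - 1)) - L ((gr_of y - 1) * (gr_of x - 1)).
Proof.
move=> nR LB L0 Rx Ry.
have [|_ I2] := @commutator_rel_pow R 0 x y nR Rx Ry.
  by apply: mem_rel_ideal => //; apply: nR.1.1.
by rewrite -LB; apply/eqP; rewrite -subr_eq0 -LB L0.
Qed.

(** Replace both commutators by their leading terms. The outer error lies in r^4; the inner one lies
    in r^3 and is multiplied by Z in r, so L kills both. *)
Lemma functional_triple_commutator R L x y z : normal_subgroup R -> zmod_morphism L ->
    (forall u, rel_pow R 3 u -> L u = 0) -> R x -> R y -> R z ->
  let X := gr_of x - 1 in let Y := gr_of y - 1 in let Z := gr_of z - 1 in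
  L (gr_of [~ x, y, z]%g - 1) =
  L (X * Y * Z) - L (Y * X * Z) - L (Z * X * Y) + L (Z * Y * X).
Proof.
move=> nR LB L0 Rx Ry Rz X Y Z; have [sR _] := nR.
have rX : rel_ideal R Z by apply: mem_rel_ideal => //; apply: sR.1.
have [|_ I2] := @commutator_rel_pow R 0 x y nR Rx Ry.
  by apply: mem_rel_ideal => //; apply: sR.1.
set w := [~ x, y]%g in I2 *; rewrite -/X -/Y in I2.
have Rw : R w by apply: subgroupR.
have Gw : dimension_subgroup (rel_pow R 1) w.
  by apply: (@lower_central_dimension F R 1 nR); apply: mem_commutator.
have [_ I3] := @commutator_rel_pow R 1 w z nR Rw Rz Gw; rewrite -/Z in I3.
set W := gr_of w - 1 in I2 I3.
have -> : L (gr_of [~ w, z]%g - 1) = L (W * Z) - L (Z * W).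
  by rewrite -LB; apply/eqP; rewrite -subr_eq0 -LB L0.
have -> : L (W * Z) = L (X * Y * Z) - L (Y * X * Z).
  rewrite -LB -mulrBl; apply/eqP; rewrite -subr_eq0 -LB -mulrBl L0 //.
  exact: mem_ideal_mul.
have -> : L (Z * W) = L (Z * X * Y) - L (Z * Y * X).
  rewrite -LB -!mulrA -mulrBr; apply/eqP; rewrite -subr_eq0 -LB -mulrBr L0 // -rel_powSr.
  exact: (mem_ideal_mul rX I2).
by rewrite opprB addrA addrAC.
Qed.

End LowerCentralFunctionals.

(** * Dimension subgroups of the products r I r *)

Section DimensionSubgroup.
Variables (F : groupType) (X : Type) (i : X -> F).
Hypothesis freeF : free_on i.
Implicit Types (R S : set F) (I : set (group_ring F)).

(** The indicator function of R is invariant under left multiplication by R, so its linear extension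
    kills r; evaluate it at g - 1. *)
Lemma dimension_rel_ideal R : subgroup R -> dimension_subgroup (rel_ideal R) `<=` R.
Proof.
move=> sR g Rg; pose c x : int := if `[<R x>] then 1 else 0.
have cM a x : R a -> c (a * x)%g = c x.
  move=> Ra; rewrite /c (asbool_equiv_eq (Q := R x)) //; split=> [Rax|Rx].
    by rewrite -[x](mulKg a); apply: subgroupM => //; apply: subgroupV.
  exact: subgroupM.
have sL := ker_additive (@gr_linB F _ c).
have cr : rel_ideal R `<=` [set u | lin c u = 0].
  apply: (rel_ideal_subP sL) => h w Rh.
  apply: (@gr_ind _ [set w | lin c ((gr_of h - 1) * w) = 0]) => [|x].
    exact: (preim_mull_additive _ sL).
  by rewrite /= mulrBl mul1r -gr_ofM gr_linB !lin_gr_of cM // subrr.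
have /= := cr _ Rg; rewrite gr_linB -gr_of1 !lin_gr_of /c (asboolT sR.1).
by case: asboolP.
Qed.

(** r I r lies in r Delta(F), which is killed by the form of [middle_form_sf] for S = R. That form
    takes g - 1 to f g, so every homomorphism f : R -> Z vanishes at g. *)
Lemma dimension_sandwich_derived R I : normal_subgroup R -> ideal I ->
  dimension_subgroup (rel_ideal R ** I ** rel_ideal R) `<=` commutator_subgroup R R.
Proof.
move=> nR iI g; rewrite /dimension_subgroup /= => Ig; have [sR _] := nR.
have ir := rel_ideal_ideal nR.
have Rg : R g.
  apply: (dimension_rel_ideal sR).
  by apply: (@ideal_mul_subr _ (rel_ideal R ** I)) Ig.
apply: (hom_separation freeF sR Rg) => f fM.
have [C [CB Cf] C0] := middle_form_sf nR (@subset_refl _ R) fM.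
have R1 := sR.1; have := Cf _ _ _ R1 Rg R1; rewrite gr_of1 mul1r mulr1 => <-.
apply: C0; apply: ideal_mulS Ig; last exact: rel_ideal_aug.
exact: ideal_mul_subl.
Qed.

(** Expand g in R'/gamma_3(R) over a basis adapted to S = R. The bilinear functionals show that the
    coefficient matrix is symmetric, whereas the commutators are alternating. *)
Lemma dimension_rfr R : normal_subgroup R ->
  dimension_subgroup (rel_ideal R ** aug_ideal setT ** rel_ideal R) `<=` lower_central R 3.
Proof.
move=> nR g Ig; have [sR _] := nR.
have R'g : commutator_subgroup R R g.
  by apply: dimension_sandwich_derived Ig => //; apply: aug_ideal_ideal.
have sR' := commutator_is_subgroup R R.
have sR3 : subgroup (lower_central R 3) by apply: (lower_central_normal 3 nR).1.
have nR' := commutator_normal nR nR.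
have R'R : commutator_subgroup R R `<=` R by apply: commutator_normal_sub.
have [||Q [q [_ [qM q0 q1 _ _]]]] := abelian_quotient sR' sR3.
- exact: commutator_normal_sub.
- by move=> x y Rx /R'R Ry; apply: mem_commutator.
apply: q0 => //.
have [s sRs es] := commutator_expansion nR R'g.
have [n [e [f [E gen]]]] := adapted_basis_exists freeF nR nR (@subset_refl _ R) sRs.
have [m mE] := es e n gen; rewrite (mE Q q) //.
have Re := adapted_mem E.
apply: (@bilinear_sum_eq0 _ n (fun a b => q [~ e a, e b]%g)) => [a|a b|a b an bn].
- by rewrite commgg; apply: q1; apply: sR3.1.
- by rewrite -invgR (hom_onV sR' qM) //; apply: mem_commutator.
have [[faM faN0] [fbM fbN0]] := (adapted_hom E an, adapted_hom E bn).
have [L [LB L0 LE]] := bilinear_functional freeF nR faM fbM.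
have L2 u : rel_pow R 2 u -> L u = 0.
  move=> ru; apply: L0; apply: ideal_mulS ru => //; apply: ideal_mulS => //.
  exact: rel_ideal_aug.
have LR := @functional_central_hom F R L 0 nR LB L2.
have fE k l : (k < n)%N -> (l < n)%N -> k <> l -> f k (e l) = 0 by apply: (adapted_diag E).
have := mE _ _ LR; rewrite L0 // => /esym.
have L2E k l : L (gr_of [~ e k, e l]%g - 1) =
    f a (e k) * f b (e l) - f a (e l) * f b (e k).
  by rewrite (functional_commutator nR LB L2) // !LE.
under eq_bigr => k _ do under eq_bigr => l _ do rewrite L2E.
rewrite (@lie_sum2_diag n a b (fun k => f a (e k)) (fun k => f b (e k))) //;
  try by move=> l; apply: fE.
move/eqP; rewrite !mulf_eq0 (negPf faN0) (negPf fbN0) /= subr_eq0 => /eqP mab.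
exact: mab.
Qed.

(** A general I treats s f and f s together; they differ only in the middle forms that kill them. *)
Lemma dimension_sandwich R S I (T := R `&` commutator_subgroup S S) :
    normal_subgroup R -> normal_subgroup S -> R `<=` S -> ideal I -> I `<=` aug_ideal setT ->
    (forall f : F -> int, hom_on S f -> exists2 C, middle_form R f C & forall u, I u -> C u = 0) ->
    rel_pow R 3 `<=` rel_ideal R ** I ** rel_ideal R ->
  dimension_subgroup (rel_ideal R ** I ** rel_ideal R) `<=`
  subset_mul (commutator_subgroup (commutator_subgroup T T) R) (lower_central R 4).
Proof.
move=> nR nS RS iI If CI rI g Ig; have [sR _] := nR; have [sS _] := nS.
have R3g : lower_central R 3 g.
  by apply: dimension_rfr => //; apply: ideal_mulS Ig => //; apply: ideal_mulS.
set K := subset_mul _ _.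
have nR3 := lower_central_normal 3 nR; have [sR3 _] := nR3.
have nR4 := lower_central_normal 4 nR; have [sR4 _] := nR4.
have sTTR := commutator_is_subgroup (commutator_subgroup T T) R.
have sK : subgroup K := subset_mul_subgroup sTTR nR4.
have R4K : lower_central R 4 `<=` K.
  by move=> x Rx; exists 1%g; [exact: sTTR.1 | exists x; rewrite ?mul1g].
have TTRK : commutator_subgroup (commutator_subgroup T T) R `<=` K.
  by move=> x Tx; exists x => //; exists 1%g; [exact: sR4.1 | rewrite mulg1].
have TR : T `<=` R by move=> x [].
have R3R : lower_central R 3 `<=` R := @lower_central_sub F R 2 nR.
(* Q is gamma_3(R)/K, abelian because K contains gamma_4(R); the goal becomes q g = 0. *)
have [||Q [q [_ [qM q0 q1 _ _]]]] := abelian_quotient sR3 sK.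
- move=> _ [x Tx [y Ry <-]]; apply: (subgroupM sR3).
    exact: (commutator_sub (commutator_sub TR TR) (@subset_refl _ R) Tx).
  exact: (commutator_normal_sub nR3 Ry).
- by move=> x y Rx /R3R Ry; apply: R4K; apply: mem_commutator.
apply: q0 => //.
have [s sRs es] := triple_commutator_expansion nR R3g.
have [n [e [f [E gen]]]] := adapted_basis_exists freeF nR nS RS sRs.
have [m mE] := es e n gen.
have cq : central_hom (commutator_subgroup R R) R q by split=> // x /R4K; apply: q1.
have Re := adapted_mem E.
have nR' := commutator_normal nR nR.
have R'R : commutator_subgroup R R `<=` R by apply: commutator_normal_sub.
rewrite (mE Q q) //.
apply: (@lie_sum_eq0 _ n (fun k => commutator_subgroup S S (e k))
  (fun a b c => q [~ e a, e b, e c]%g) m).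
- by move=> a c; rewrite commgg comm1g; apply: q1; apply: sK.1.
- move=> a b c; rewrite -(invgR (e b) (e a)).
  apply: (hom_onV (commutator_is_subgroup R R) (central_hom_commMl nR' nR R'R cq (Re c))).
  exact: mem_commutator.
- by move=> a b c; apply: (triple_commutator_jacobi nR cq).
- exact: (adapted_up E).
- move=> a b c an bn Sa Sb; apply: q1; apply: TTRK.
  by do 2!apply: mem_commutator => //.
move=> a b c an bn cn Sb.
have [[faM faN0] [fbM fbN0]] := (adapted_hom E an, adapted_hom E bn).
have [fcM fcN0] := adapted_hom E cn.
(* Since e b is outside S', the form f b agrees on R with a homomorphism h on S, for which a middle
   form killing I is available. *)
have [//|[h hM fbh]] := adapted_ext E bn.
have [C Cf C0] := CI h hM.
have [L [LB L0 LE]] := trilinear_functional freeF nR faM fcM iI Cf C0.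
have L3 u : rel_pow R 3 u -> L u = 0 by move=> /rI/L0.
have LR := @functional_central_hom F R L 1 nR LB L3.
have fE k l : (k < n)%N -> (l < n)%N -> k <> l -> f k (e l) = 0 by apply: (adapted_diag E).
have := mE _ _ LR; rewrite L0 // => /esym.
have L3E k l p : L (gr_of [~ e k, e l, e p]%g - 1) =
    f a (e k) * f b (e l) * f c (e p) - f a (e l) * f b (e k) * f c (e p)
    - f a (e p) * f b (e k) * f c (e l) + f a (e p) * f b (e l) * f c (e k).
  have LfE x y z : R x -> R y -> R z ->
      L ((gr_of x - 1) * (gr_of y - 1) * (gr_of z - 1)) = f a x * f b y * f c z.
    by move=> Rx Ry Rz; rewrite LE // fbh.
  rewrite (functional_triple_commutator nR LB L3) //.
  by congr (_ - _ - _ + _); apply: LfE.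
under eq_bigr => k _ do under eq_bigr => l _ do under eq_bigr => p _ do rewrite L3E.
(* The vanishing sum is f a (e a) * f b (e b) * f c (e c) times the coefficient of e_a e_b e_c, and
   the first three factors are nonzero. *)
move=> sum0; have := @lie_sum3_diag n a b c (fun k => f a (e k)) (fun k => f b (e k))
  (fun k => f c (e k)) m an bn cn.
rewrite /sum3 sum0 => /(_ _ _ _)/esym/eqP.
rewrite !mulf_eq0 (negPf faN0) (negPf fbN0) (negPf fcN0) /= => mabc.
by apply/eqP; apply: mabc => l; apply: fE.
Qed.

(** For x in T, x - 1 lies both in r and in s^2, so [T, T] - 1 lies in r s^2 and in s^2 r. One more
    commutator with R gives r s^2 r, which also contains r^4. *)
Lemma triple_commutator_dimension R S (T := R `&` commutator_subgroup S S) :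
    normal_subgroup R -> normal_subgroup S -> R `<=` S ->
  subset_mul (commutator_subgroup (commutator_subgroup T T) R) (lower_central R 4) `<=`
  dimension_subgroup (rel_ideal R ** (rel_ideal S ** rel_ideal S) ** rel_ideal R).
Proof.
move=> nR nS RS; have [sR _] := nR; have [sS _] := nS.
set r := rel_ideal R; set s := rel_ideal S.
have ir : ideal r by apply: rel_ideal_ideal.
have is_ : ideal s by apply: rel_ideal_ideal.
have iss : ideal (s ** s) by apply: ideal_mul_ideal.
have irss : ideal (r ** (s ** s)) by apply: ideal_mul_ideal.
have issr : ideal (s ** s ** r) by apply: ideal_mul_ideal.
have irssr : ideal (r ** (s ** s) ** r) by apply: ideal_mul_ideal.
have memR x : R x -> r (gr_of x - 1) by apply: mem_rel_ideal; apply: sR.1.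
have memS x : S x -> s (gr_of x - 1) by apply: mem_rel_ideal; apply: sS.1.
have S'ss : commutator_subgroup S S `<=` dimension_subgroup (s ** s).
  by apply: commutator_dimension => // x y Sx Sy; apply: mem_ideal_mul; apply: memS.
have TTl : commutator_subgroup T T `<=` dimension_subgroup (r ** (s ** s)).
  by apply: commutator_dimension => // x y [Rx Sx] [Ry Sy]; apply: mem_ideal_mul;
    by [apply: memR | apply: S'ss].
have TTr : commutator_subgroup T T `<=` dimension_subgroup (s ** s ** r).
  by apply: commutator_dimension => // x y [Rx Sx] [Ry Sy]; apply: mem_ideal_mul;
    by [apply: memR | apply: S'ss].
have sD := dimension_subgroup_subgroup irssr.
move=> _ [x Tx [y Ry <-]]; apply: (subgroupM sD).
  move: x Tx; apply: commutator_dimension => // x z Tx Rz.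
    by apply: mem_ideal_mul; [apply: TTl | apply: memR].
  by rewrite ideal_mulA; apply: mem_ideal_mul; [apply: memR | apply: TTr].
have := @lower_central_dimension F R 3 nR y Ry; rewrite /dimension_subgroup /=.
have rs : r `<=` s by apply: rel_idealS.
rewrite -/r [r ** r ** r]ideal_mulA; apply: ideal_mulS => //.
by apply: ideal_mulS => //; apply: ideal_mulS.
Qed.

End DimensionSubgroup.

Theorem theorem5p5 (F : groupType) (R S : set F)
    (freeF : free_group F)
    (normR : normal_subgroup R) (normS : normal_subgroup S)
    (subRS : R `<=` S) :
  let r := rel_ideal R in
  let s := rel_ideal S in
  let f := aug_ideal setT in
  let T := R `&` commutator_subgroup S S in
  dimension_subgroup (r ** s ** f ** r) = dimension_subgroup (r ** f ** s ** r)
  /\ dimension_subgroup (r ** f ** s ** r) =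
     subset_mul (commutator_subgroup (commutator_subgroup T T) R)
                (lower_central R 4).
Proof.
move=> r s f T; have [X [i freeFi]] := freeF.
have idS : ideal s := rel_ideal_ideal normS.
have idF : ideal f := @aug_ideal_ideal F.
have rs : r `<=` s by apply: rel_idealS.
have sf : s `<=` f by apply: rel_ideal_aug.
have rf : r `<=` f by apply: rel_ideal_aug.
pose K := subset_mul (commutator_subgroup (commutator_subgroup T T) R) (lower_central R 4).
(* Both s f and f s satisfy these conditions. As r^2 lies in s^2 and thus in I, the power r^4 lies
   in r I r. *)
have DK I : ideal I -> I `<=` f -> s ** s `<=` I ->
    (forall g : F -> int, hom_on S g -> exists2 C, middle_form R g C & forall u, I u -> C u = 0) ->
  dimension_subgroup (r ** I ** r) = K.
  move=> iI If ssI CI; apply/seteqP; split.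
    apply: (dimension_sandwich freeFi) => //; rewrite /rel_pow /= (ideal_mulA r r r).
    apply: ideal_mulS => //; apply: ideal_mulS => //.
    by apply: (subset_trans _ ssI); apply: ideal_mulS.
  apply: subset_trans (triple_commutator_dimension normR normS subRS) _ => x.
  by apply: ideal_mulS => //; apply: ideal_mulS.
have -> : r ** s ** f ** r = r ** (s ** f) ** r by rewrite (ideal_mulA r).
have -> : r ** f ** s ** r = r ** (f ** s) ** r by rewrite (ideal_mulA r).
have -> : dimension_subgroup (r ** (s ** f) ** r) = K.
  apply: DK => [|||g gM]; first exact: ideal_mul_ideal.
  - exact: ideal_mul_subr.
  - exact: ideal_mulS.
  exact: middle_form_sf gM.
have -> // : dimension_subgroup (r ** (f ** s) ** r) = K.
apply: DK => [|||g gM]; first exact: ideal_mul_ideal.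
- exact: ideal_mul_subl.
- exact: ideal_mulS.
exact: middle_form_fs gM.
Qed.
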